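(* Every finite graph $G$ has a canonical tree-decomposition $\mathcal{T}$ that distinguishes efficiently every two distinct maximal robust profiles of $G$, and which has the further property that every separable block of $G$ inducing a maximal robust profile is equal to the unique part of $\mathcal{T}$ in which it is contained.
   Context: All graphs are finite, simple and undirected. Separations. A separation of $G$ is an ordered pair $(A,B)$ of subsets of $V(G)$ with $A\cup B=V(G)$ and no edge between $A\setminus B$ and $B\setminus A$; its order is $|A\cap B|$. Write $(A,B)\le(C,D)$ iff $A\subseteq C$ and $D\subseteq B$. $S_{<k}$ is the set of all separations of $G$ of order less than $k$. A separation $(A,B)$ separates $X\subseteq V(G)$ if $X$ meets both $A\setminus B$ and $B\setminus A$. Blocks. A $k$-block of $G$ is an inclusion-maximal set $b\subseteq V(G)$ separated by no element of $S_{<k}$, with $|b|\ge k$. A block is a $k$-block for some $k\in\mathbb{N}$. Profiles. A $k$-profile of $G$ is a set $P\subseteq S_{<k}$ such that: (orientation) for every $(A,B)\in S_{<k}$ exactly one of $(A,B),(B,A)$ is in $P$; (consistency) if $(A,B)\in P$, $(C,D)\in S_{<k}$ and $(C,D)\le(A,B)$ then $(C,D)\in P$; and (P) for all $(A,B),(C,D)\in P$ we have $(B\cap D,A\cup C)\notin P$. A $k$-block $b$ induces the $k$-profile $P_k(b)=\{(A,B)\in S_{<k}: b\subseteq B\}$. For $r\in\mathbb{N}$, a $k$-profile $P$ is $r$-robust if for any $(A,B)\in P$ and any $(C,D)\in S_{<r+1}$ one of $(A\cup C,B\cap D)$, $(A\cup D,B\cap C)$ either has order at least $k-1$ or is in $P$.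 $P$ is robust if it is $r$-robust for all $r\in\mathbb{N}$. A robust $k$-profile $P$ is maximal (a maximal robust profile) if there is no robust $\ell$-profile $Q$ with $\ell>k$ and $P\subsetneq Q$. A separation $(A,B)$ distinguishes two profiles $P,Q$ if $(A,B)$ lies in one of them and $(B,A)$ in the other; it does so efficiently if its order is minimum among all separations distinguishing $P$ and $Q$. Tree-decompositions. A tree-decomposition of $G$ is a pair $(T,(P_t)_{t\in V(T)})$ of a tree $T$ and sets $P_t\subseteq V(G)$ (the parts) such that $\bigcup_t P_t=V(G)$, every edge of $G$ has both ends in some $P_t$, and $P_{t_1}\cap P_{t_3}\subseteq P_{t_2}$ whenever $t_2$ lies on the $t_1$–$t_3$ path in $T$. Its adhesion is the maximum size of an adhesion set $P_t\cap P_{t'}$, $tt'\in E(T)$. An oriented edge $t_1t_2$ of $T$ induces the separation $(\bigcup_{t\in V(T_1)}P_t,\bigcup_{t\in V(T_2)}P_t)$, where $T_i$ is the component of $T-t_1t_2$ containing $t_i$; these are the separations induced by the tree-decomposition. It distinguishes two profiles (efficiently) if some separation induced by it distinguishes them (efficiently). It is canonical if for every automorphism $\varphi$ of $G$ there is an automorphism $\psi$ of $T$ with $\varphi[P_t]=P_{\psi(t)}$ for all $t\in V(T)$. A $k$-block $b$ is separable if there is a tree-decomposition of $G$ of adhesion less than $k$ that has $b$ as one of its parts. ''A separable block inducing a maximal robust profile'' is a separable $k$-block $b$ (for some $k$) such that $P_k(b)$ is a maximal robust profile. *)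

(* Defs.v *)
From HB Require Import structures.
From mathcomp Require Import all_boot all_fingroup.

Set Implicit Arguments.
Unset Strict Implicit.
Unset Printing Implicit Defensive.

Record sgraph := SGraph {
  vert :> finType;
  adj : rel vert;
  adj_sym : symmetric adj;
  adj_irrefl : irreflexive adj }.

Definition graph_aut (G : sgraph) (f : {perm G}) : Prop :=
  forall x y : G, adj (f x) (f y) = adj x y.

(* An ordered pair [(A, B)]; being a separation is the predicate [is_sep]. *)
Definition sep_pair (G : sgraph) : finType := ({set G} * {set G})%type.

Section Separations.
Variable G : sgraph.
Implicit Types (s u : sep_pair G) (X : {set G}) (k : nat).

Definition is_sep s : bool :=
  (s.1 :|: s.2 == [set: G]) &&
  [forall x in s.1 :\: s.2, forall y in s.2 :\: s.1, ~~ adj x y].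

Definition sep_order s : nat := #|s.1 :&: s.2|.

Definition sep_le s u : bool := (s.1 \subset u.1) && (u.2 \subset s.2).

Definition sep_inv s : sep_pair G := (s.2, s.1).

Definition sep_join s u : sep_pair G := (s.1 :|: u.1, s.2 :&: u.2).

Definition seps_lt k : {set sep_pair G} :=
  [set s | is_sep s && (sep_order s < k)].

Definition separates s X : bool :=
  (X :&: (s.1 :\: s.2) != set0) && (X :&: (s.2 :\: s.1) != set0).

End Separations.

Section Profiles.
Variable G : sgraph.
Implicit Types (P Q : {set sep_pair G}) (b : {set G}) (k l r : nat).

Definition inseparable k : pred {set G} :=
  fun X => [forall s in seps_lt G k, ~~ separates s X].

Definition is_block k b : bool := maxset (inseparable k) b && (k <= #|b|).

Definition is_profile k P : Prop :=
  [/\ P \subset seps_lt G k,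
      forall s, s \in seps_lt G k -> (s \in P) (+) (sep_inv s \in P),
      forall s u, s \in P -> u \in seps_lt G k -> sep_le u s -> u \in P
    & forall s u, s \in P -> u \in P -> sep_inv (sep_join s u) \notin P].

Definition block_profile k b : {set sep_pair G} :=
  [set s in seps_lt G k | b \subset s.2].

(* Here [u] = (C, D), so the two candidates for [c] are the corners
   (A \cup C, B \cap D) and (A \cup D, B \cap C) of [s] = (A, B). A 0-profile
   is empty, so truncation in [k.-1] is harmless. *)
Definition r_robust k r P : Prop :=
  forall s u, s \in P -> u \in seps_lt G r.+1 ->
    exists2 c, c \in [:: sep_join s u; sep_join s (sep_inv u)] &
      (k.-1 <= sep_order c) || (c \in P).

Definition robust_profile k P : Prop :=
  is_profile k P /\ forall r, r_robust k r P.

Definition max_robust_profile k P : Prop :=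
  robust_profile k P /\
  forall l Q, k < l -> robust_profile l Q -> ~~ (P \proper Q).

Definition distinguishes (s : sep_pair G) P Q : bool :=
  is_sep s && ((s \in P) && (sep_inv s \in Q) || (s \in Q) && (sep_inv s \in P)).

Definition distinguishes_eff (s : sep_pair G) P Q : Prop :=
  distinguishes s P Q /\
  forall u, distinguishes u P Q -> sep_order s <= sep_order u.

End Profiles.

(* An edge traversed back and forth is a [ucycle] of size 2, so only longer
   cycles are excluded. *)
Definition is_tree (T : sgraph) : Prop :=
  [/\ 0 < #|T|,
      forall x y : T, connect (@adj T) x y
    & forall c : seq T, ucycle (@adj T) c -> size c <= 2].

Record tree_dec (G : sgraph) := TreeDec {
  td_tree : sgraph;
  part : td_tree -> {set G};
  td_is_tree : is_tree td_tree;
  td_cover : \bigcup_t part t = [set: G];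
  td_edge : forall x y : G, adj x y ->
    exists t, (x \in part t) && (y \in part t);
  (* Simple paths of a tree are unique, so [t1 :: p] is the path from [t1] to
     [last t1 p]. *)
  td_path : forall (t1 t2 : td_tree) (p : seq td_tree),
    path (@adj td_tree) t1 p -> uniq (t1 :: p) -> t2 \in t1 :: p ->
    part t1 :&: part (last t1 p) \subset part t2 }.

Section TreeDecompositions.
Variables (G : sgraph) (T : tree_dec G).
Implicit Types (t : td_tree T) (P Q : {set sep_pair G}).

(* Without edges the maximum is taken to be 0; when asking for adhesion [< k]
   this convention matters for [k = 0] only. *)
Definition adhesion : nat :=
  \max_(e : td_tree T * td_tree T | adj e.1 e.2) #|part e.1 :&: part e.2|.

Definition tree_del_edge t1 t2 : rel (td_tree T) :=
  fun t t' => adj t t' && ((t, t') \notin [:: (t1, t2); (t2, t1)]).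

Definition edge_side t1 t2 : {set G} :=
  \bigcup_(t | connect (tree_del_edge t1 t2) t1 t) part t.

Definition induced_sep t1 t2 : sep_pair G :=
  (edge_side t1 t2, edge_side t2 t1).

Definition td_distinguishes_eff P Q : Prop :=
  exists t1 t2, adj t1 t2 /\ distinguishes_eff (induced_sep t1 t2) P Q.

Definition td_canonical : Prop :=
  forall f : {perm G}, graph_aut f ->
    exists2 g : {perm td_tree T}, graph_aut g &
      forall t, f @: part t = part (g t).

End TreeDecompositions.

Definition separable_block (G : sgraph) (k : nat) (b : {set G}) : Prop :=
  is_block k b /\
  exists T : tree_dec G, adhesion T < k /\ exists t, @part G T t = b.

(* Main.v *)
(* Among the separations that efficiently distinguish two maximal
   robust profiles, choose order by order those that cross no previously chosen
   one and, subject to this, cross as few competitors as possible.  Uncrossing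
   by submodularity shows that the chosen separations are pairwise nested;
   robustness is needed only when the two orders differ.

   Let [b] be a separable [k]-block inducing a maximal robust profile, so that
   every component [C] of [G - b] has fewer than [k] neighbours.  A chosen
   separation [(A, B)] with [b] on its [B]-side that is maximal efficiently
   distinguishes [P_k(b)] from some robust profile [Q], and robustness of [Q]
   then shows that [A :&: B] avoids [C] or is contained in [C :|: N(C)].  Hence
   the join of [(C :|: N(C), ~: C)] with the maximal [(A, B)] whose [A :&: B]
   meets [C] is nested with every chosen separation, and adding these joins
   keeps the system nested and cuts off everything outside [b].

   The nodes of the tree are the consistent orientations of the resulting
   nested system, two of them being adjacent when they differ in exactly one
   separation. *)

Require Import Defs.
From mathcomp Require Import all_boot all_fingroup.
From Stdlib Require Import Classical ClassicalEpsilon.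
From mathcomp Require Import zify.

Set Implicit Arguments.
Unset Strict Implicit.
Unset Printing Implicit Defensive.

(** * Separations *)

Section SeparationOrder.
Variable G : sgraph.
Implicit Types (s t u : sep_pair G).

(** Canonicity forbids choosing one distinguisher per pair of profiles, so all minimisers for all
    pairs are kept, and minimisers for unrelated pairs have to be nested too. Their crossing counts
    become comparable because they refer to one common set, the candidates of all pairs at that
    order: two opposite corners together cross strictly fewer of these than the two crossing
    separations do, so the corners cannot both be competitors of the minimisers. The obstacle for a
    block [b] is that [(C :|: N(C), ~: C)] may cross distinguishers. Nothing bounds the order of the
    joins that repair this, so profiles need not orient them. They are oriented by inclusion
    instead: a block lies in exactly one side of each separation of the final system. Nestedness
    with the distinguishers comes from the star that the maximal distinguishers form around [b], and
    two different blocks are kept apart by a distinguisher between them. Separability enters through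
    the bound on [N(C)], which makes [b] recoverable from its profile and prevents [b] from lying
    inside the first side of a join. *)

Definition nested s u : bool :=
  [|| sep_le s u, sep_le s (sep_inv u), sep_le (sep_inv s) u
    | sep_le (sep_inv s) (sep_inv u)].

Lemma sep_invK : involutive (@sep_inv G).
Proof. by case. Qed.

Lemma sep_le_refl s : sep_le s s.
Proof. by rewrite /sep_le !subxx. Qed.

Lemma sep_le_trans u s t : sep_le s u -> sep_le u t -> sep_le s t.
Proof.
case/andP=> a1 a2 /andP[b1 b2]; apply/andP; split.
  exact: subset_trans a1 b1.
exact: subset_trans b2 a2.
Qed.

Lemma sep_le_inv s u : sep_le (sep_inv s) (sep_inv u) = sep_le u s.
Proof. by rewrite /sep_le /= andbC. Qed.

Lemma sep_le_invl s u : sep_le (sep_inv s) u = sep_le (sep_inv u) s.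
Proof. by rewrite -{1}[u]sep_invK sep_le_inv. Qed.

Lemma sep_le_invr s u : sep_le s (sep_inv u) = sep_le u (sep_inv s).
Proof. by rewrite -{1}[s]sep_invK sep_le_inv. Qed.

Lemma nested_sym s u : nested s u = nested u s.
Proof.
rewrite /nested !sep_le_inv (sep_le_invl s u) (sep_le_invr s u).
by do 4!case: (sep_le _ _).
Qed.

Lemma nested_invl s u : nested (sep_inv s) u = nested s u.
Proof. by rewrite /nested sep_invK; do 4!case: (sep_le _ _). Qed.

Lemma nested_invr s u : nested s (sep_inv u) = nested s u.
Proof. by rewrite nested_sym nested_invl nested_sym. Qed.

Lemma nested_refl s : nested s s.
Proof. by rewrite /nested sep_le_refl. Qed.

Lemma sep_le_nested s u : sep_le s u -> nested s u.
Proof. by rewrite /nested => ->. Qed.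

Lemma sep_order_inv s : sep_order (sep_inv s) = sep_order s.
Proof. by rewrite /sep_order setIC. Qed.

Lemma is_sepP s :
  reflect ((forall x, (x \in s.1) || (x \in s.2)) /\
           (forall x y, adj x y ->
              (x \in s.1) && (y \in s.1) || (x \in s.2) && (y \in s.2)))
          (is_sep s).
Proof.
apply: (iffP andP) => [[/eqP cov /forall_inP noe]|[cov noe]].
  have {}cov x : (x \in s.1) || (x \in s.2) by rewrite -in_setU cov inE.
  split=> // x y xy; move: (cov x) (cov y).
  have h z w : adj z w -> z \in s.1 -> z \notin s.2 -> w \in s.2 ->
      w \notin s.1 -> false.
    move=> zw z1 z2 w2 w1.
    have /forall_inP/(_ w) : [forall y in s.2 :\: s.1, ~~ adj z y].
      by apply: noe; rewrite !inE z1 z2.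
    by rewrite !inE w1 w2 zw => /(_ isT).
  move: (h x y xy) (h y x); rewrite adj_sym => h1 /(_ xy) h2; move: h1 h2.
  case: (x \in s.1) (x \in s.2) (y \in s.1) (y \in s.2) => [] [] [] [] //=;
    try by move=> /(_ isT isT isT isT).
  by move=> _ /(_ isT isT isT isT).
split.
  by apply/eqP/setP=> x; rewrite !inE cov.
apply/forall_inP=> x; rewrite !inE => /andP[x2 x1].
apply/forall_inP=> y; rewrite !inE => /andP[y1 y2].
by apply/negP=> /noe; rewrite (negbTE x2) (negbTE y1) andbF.
Qed.

Lemma is_sep_inv s : is_sep (sep_inv s) = is_sep s.
Proof.
have h t : is_sep t -> is_sep (sep_inv t).
  case/is_sepP=> [a b]; apply/is_sepP; split=> /= [x|x y /b].
    by rewrite orbC.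
  by rewrite orbC.
by apply/idP/idP => /h //; rewrite sep_invK.
Qed.

Lemma is_sep_join s u : is_sep s -> is_sep u -> is_sep (sep_join s u).
Proof.
case/is_sepP=> [a b] /is_sepP[c d]; apply/is_sepP; split=> /= [x|x y xy].
  rewrite !inE; move: (a x) (c x).
  by case: (x \in s.1) (x \in s.2) (x \in u.1) (x \in u.2) => [] [] [] [].
rewrite !inE; move: (b x y xy) (d x y xy).
case: (x \in s.1) (x \in s.2) (y \in s.1) (y \in s.2) => [] [] [] [] //= _;
by case: (x \in u.1) (x \in u.2) (y \in u.1) (y \in u.2) => [] [] [] [].
Qed.

Lemma sep_le_joinl s u : sep_le s (sep_join s u).
Proof. by rewrite /sep_le subsetUl subsetIl. Qed.

Lemma sep_le_joinr s u : sep_le u (sep_join s u).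
Proof. by rewrite /sep_le subsetUr subsetIr. Qed.

Lemma sep_join_le s u t : sep_le s t -> sep_le u t -> sep_le (sep_join s u) t.
Proof.
by case/andP=> a b /andP[c d]; rewrite /sep_le /= subUset a c subsetI b d.
Qed.

Lemma sep_max_above (A : {set sep_pair G}) s : s \in A ->
  exists u, [/\ u \in A, sep_le s u & forall w, w \in A -> sep_le u w -> w = u].
Proof.
(* The measure grows strictly along [sep_le], so a maximiser above [s] is a maximal element. *)
move=> sA; pose m u := #|u.1| + #|~: u.2|.
pose above u := (u \in A) && sep_le s u.
have s_above : above s by rewrite /above sA sep_le_refl.
case: (@arg_maxnP _ s above m s_above) => u /andP[uA su] umax.
exists u; split=> // w wA uw.
have := umax w; rewrite /above wA (sep_le_trans su uw) => /(_ isT) le.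
case/andP: uw => uw1 uw2; have c1 := subset_leq_card uw1.
have c2 : #|~: u.2| <= #|~: w.2| by rewrite subset_leq_card // setCS.
have /eqP e1 : u.1 == w.1.
  by rewrite eqEcard uw1; move: le c1 c2; rewrite /m; clear; lia.
have /eqP/setC_inj e2 : ~: u.2 == ~: w.2.
  by rewrite eqEcard setCS uw2; move: le c1 c2; rewrite /m; clear; lia.
by rewrite [w]surjective_pairing -e1 -e2 -surjective_pairing.
Qed.

Lemma order_corners s u :
  sep_order (sep_join s u) + sep_order (sep_join (sep_inv s) (sep_inv u))
    <= sep_order s + sep_order u.
Proof.
rewrite /sep_order -cardsUI -(cardsUI (s.1 :&: s.2)) leq_add // subset_leq_card //.
  apply/subsetP=> x; rewrite !inE.
  by case: (x \in s.1) (x \in s.2) (x \in u.1) (x \in u.2) => [] [] [] [].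
apply/subsetP=> x; rewrite !inE.
by case: (x \in s.1) (x \in s.2) (x \in u.1) (x \in u.2) => [] [] [] [].
Qed.

(** An orientation of [t] below [s] or [u] is below the join, and an orientation of [t] above both
    is above the join. In the remaining case [s] and [u] lie below opposite orientations of [t],
    which would make them nested. *)
Lemma nested_join s u t :
  ~~ nested s u -> nested t s -> nested t u -> nested t (sep_join s u).
Proof.
move=> su; rewrite {1 2}/nested !sep_le_inv.
have up w : sep_le w s || sep_le w u -> sep_le w (sep_join s u).
  case/orP=> h; apply: (sep_le_trans h); first exact: sep_le_joinl.
  exact: sep_le_joinr.
case/or4P=> ts.
- by move=> _; rewrite sep_le_nested ?up ?ts.
- case/or4P=> tu.
  + by rewrite sep_le_nested ?up ?tu ?orbT.
  + rewrite nested_sym -nested_invr sep_le_nested // sep_join_le //.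
      by rewrite sep_le_invr.
    by rewrite sep_le_invr.
  + by rewrite -nested_invl sep_le_nested ?up ?tu ?orbT.
  + case/negP: su; rewrite nested_sym -nested_invr sep_le_nested //.
    exact: sep_le_trans tu ts.
- by move=> _; rewrite -nested_invl sep_le_nested ?up ?ts.
case/or4P=> tu.
- by rewrite sep_le_nested ?up ?tu ?orbT.
- case/negP: su; rewrite -nested_invr sep_le_nested //.
  exact: sep_le_trans ts tu.
- by rewrite -nested_invl sep_le_nested ?up ?tu ?orbT.
by rewrite nested_sym sep_le_nested // sep_join_le.
Qed.

(** Some orientation of [t] lies below [s] or below [sep_inv s], hence below the corner on that
    side. *)
Lemma nested_join_opp s u t : nested t s ->
  nested t (sep_join s u) || nested t (sep_join (sep_inv s) (sep_inv u)).
Proof.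
case/or4P=> h.
- by rewrite (sep_le_nested (sep_le_trans h (sep_le_joinl _ _))).
- by rewrite (sep_le_nested (sep_le_trans h (sep_le_joinl _ _))) orbT.
- by rewrite -!(nested_invl t) (sep_le_nested (sep_le_trans h (sep_le_joinl _ _))).
- rewrite -!(nested_invl t).
  by rewrite (sep_le_nested (sep_le_trans h (sep_le_joinl _ _))) orbT.
Qed.

Lemma sep_join_comm s u : sep_join s u = sep_join u s.
Proof. by rewrite /sep_join setUC setIC. Qed.

(** * Crossing numbers *)

Definition crossing (E : {set sep_pair G}) s := [set u in E | ~~ nested s u].

(** By [nested_join] the corner crosses only what [u] crosses. Strictness is witnessed by [s], which
    lies below the corner. *)
Lemma crossing_join_proper (E : {set sep_pair G}) s u :
  s \in E -> (forall t, t \in E -> nested t s) -> ~~ nested s u ->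
  crossing E (sep_join s u) \proper crossing E u.
Proof.
move=> sE Es su; apply/properP; split.
  apply/subsetP=> t; rewrite !inE => /andP[tE]; rewrite tE /=.
  apply: contra => tu; rewrite nested_sym nested_join //; first exact: Es.
  by rewrite nested_sym.
exists s; first by rewrite inE sE nested_sym.
by rewrite inE sE /= nested_sym sep_le_nested // sep_le_joinl.
Qed.

(** Whatever crosses a corner crosses [s] or [u], and whatever crosses both corners crosses both.
    The count drops because [s] crosses [u] but neither corner. *)
Lemma crossing_corners (E : {set sep_pair G}) s u : s \in E -> ~~ nested s u ->
  #|crossing E (sep_join s u)|
    + #|crossing E (sep_join (sep_inv s) (sep_inv u))|
  < #|crossing E s| + #|crossing E u|.
Proof.
move=> sE su.
have su' : ~~ nested (sep_inv s) (sep_inv u) by rewrite nested_invl nested_invr.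
rewrite -cardsUI -(cardsUI (crossing E s)) -addSn leq_add //.
  apply/proper_card/properP; split.
    apply/subsetP=> t; rewrite !inE -!andb_orr => /andP[-> /=].
    rewrite -!negb_and ![nested _ t]nested_sym.
    apply: contra => /andP[ts tu].
    by rewrite !nested_join // nested_invr.
  exists s; rewrite !inE sE /=; first by rewrite (nested_sym u) su orbT.
  rewrite negb_or !negbK nested_sym sep_le_nested ?sep_le_joinl //=.
  by rewrite nested_sym -nested_invl sep_le_nested ?sep_le_joinl.
apply/subset_leq_card/subsetP=> t; rewrite !inE -!andbA => /and4P[-> a _ b] /=.
apply/andP; split; apply/negP => h.
  have := nested_join_opp u (s := s) (t := t).
  by rewrite nested_sym h -![nested t _]nested_sym (negbTE a) (negbTE b) => /(_ isT).
have := nested_join_opp s (s := u) (t := t).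
rewrite (sep_join_comm u) (sep_join_comm (sep_inv u)).
by rewrite nested_sym h -![nested t _]nested_sym (negbTE a) (negbTE b) => /(_ isT).
Qed.

End SeparationOrder.

(** * Profiles *)

Section ProfileTheory.
Variable G : sgraph.
Implicit Types (s t u : sep_pair G) (P Q : {set sep_pair G}) (k l : nat).

Lemma profile_sep k P s : is_profile k P -> s \in P ->
  is_sep s /\ sep_order s < k.
Proof. by case=> /subsetP sub _ _ _ /sub; rewrite inE => /andP[]. Qed.

Lemma profile_inv k P s : is_profile k P -> is_sep s -> sep_order s < k ->
  (sep_inv s \in P) = (s \notin P).
Proof.
case=> _ /(_ s) + _ _ => + ss so; rewrite inE ss so => /(_ isT).
by case: (s \in P) (sep_inv s \in P) => [] [].
Qed.

Lemma profile_invN k P s : is_profile k P -> s \in P -> sep_inv s \notin P.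
Proof.
move=> pP sP; have [a b] := profile_sep pP sP.
by rewrite (profile_inv pP) // sP.
Qed.

Lemma profile_down k P s u : is_profile k P -> s \in P -> is_sep u ->
  sep_order u < k -> sep_le u s -> u \in P.
Proof. by case=> _ _ h _ sP us uo; apply: h sP _; rewrite inE us. Qed.

Lemma profile_join k P s u : is_profile k P -> s \in P -> u \in P ->
  sep_order (sep_join s u) < k -> sep_join s u \in P.
Proof.
move=> pP sP uP o; have [ss _] := profile_sep pP sP.
have [us _] := profile_sep pP uP.
case: (pP) => _ _ _ /(_ s u sP uP).
by rewrite (profile_inv pP) ?is_sep_join // negbK.
Qed.

Lemma distinguishes_sym s P Q : distinguishes s P Q = distinguishes s Q P.
Proof. by rewrite /distinguishes orbC. Qed.

Lemma distinguishes_inv s P Q :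
  distinguishes (sep_inv s) P Q = distinguishes s P Q.
Proof.
by rewrite /distinguishes is_sep_inv sep_invK orbC [(sep_inv s \in Q) && _]andbC
  [(sep_inv s \in P) && _]andbC.
Qed.

Lemma distinguishesI s P Q : is_sep s -> s \in P -> sep_inv s \in Q ->
  distinguishes s P Q.
Proof. by rewrite /distinguishes => -> -> ->. Qed.

(** Boolean form of [distinguishes_eff], for use in set comprehensions. *)
Definition eff s P Q : bool :=
  distinguishes s P Q &&
  [forall u, distinguishes u P Q ==> (sep_order s <= sep_order u)].

Lemma effP s P Q : reflect (distinguishes_eff s P Q) (eff s P Q).
Proof.
apply: (iffP andP) => -[d h]; split=> //.
  by move=> u ud; have := forallP h u; rewrite ud.
by apply/forallP=> u; apply/implyP/h.
Qed.

Lemma eff_dist s P Q : eff s P Q -> distinguishes s P Q.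
Proof. by case/andP. Qed.

Lemma eff_min s u P Q : eff s P Q -> distinguishes u P Q ->
  sep_order s <= sep_order u.
Proof. by case/effP=> _; apply. Qed.

Lemma eff_le s u P Q : eff s P Q -> distinguishes u P Q ->
  sep_order u <= sep_order s -> eff u P Q.
Proof.
move=> es ud us; apply/effP; split=> // w wd.
exact: leq_trans us (eff_min es wd).
Qed.

Lemma eff_sym s P Q : eff s P Q = eff s Q P.
Proof.
rewrite /eff distinguishes_sym; congr andb.
by apply: eq_forallb => u; rewrite distinguishes_sym.
Qed.

Lemma eff_inv s P Q : eff (sep_inv s) P Q = eff s P Q.
Proof. by rewrite /eff distinguishes_inv sep_order_inv. Qed.

Lemma eff_exists u P Q : distinguishes u P Q -> exists s, eff s P Q.
Proof.
move=> ud; case: (@arg_minnP _ u (fun w =>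
  distinguishes w P Q) (@sep_order G) ud) => s sd smin.
by exists s; apply/effP.
Qed.

Lemma eff_sep s P Q : eff s P Q -> is_sep s.
Proof. by case/andP=> /andP[]. Qed.

Lemma dist_order s k P Q : is_profile k P -> distinguishes s P Q ->
  sep_order s < k.
Proof.
move=> pP /andP[_ /orP[]] /andP[h h'].
  by case: (profile_sep pP h).
by case: (profile_sep pP h'); rewrite sep_order_inv.
Qed.

Lemma dist_orderr s k P Q : is_profile k Q -> distinguishes s P Q ->
  sep_order s < k.
Proof. by rewrite distinguishes_sym; apply: dist_order. Qed.

Lemma dist_mem s k l P Q : is_profile k P -> is_profile l Q ->
  distinguishes s P Q -> (s \in Q) = (s \notin P).
Proof.
move=> pP pQ /andP[_ /orP[]] /andP[h h'].
  by rewrite h; apply/negP=> /(profile_invN pQ); rewrite h'.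
rewrite h; symmetry; apply/negP=> /(profile_invN pP); rewrite h'.
by [].
Qed.

Lemma not_dist s k l P Q : is_profile k P -> is_profile l Q -> is_sep s ->
  sep_order s < k -> sep_order s < l -> ~~ distinguishes s P Q ->
  (s \in P) = (s \in Q).
Proof.
move=> pP pQ ss sk sl; rewrite /distinguishes ss /= !(profile_inv pP, profile_inv
  pQ) //.
by case: (s \in P) (s \in Q) => [] [].
Qed.

Lemma dist_of_mem s k l P Q : is_profile k P -> is_profile l Q -> is_sep s ->
  sep_order s < k -> sep_order s < l -> (s \in P) != (s \in Q) ->
  distinguishes s P Q.
Proof.
move=> pP pQ ss sk sl; rewrite /distinguishes ss /= !(profile_inv pP, profile_inv
  pQ) //.
by case: (s \in P) (s \in Q) => [] [].
Qed.

(* Robustness is only ever used in this form, where both corners are smaller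
   than [s]; the bound [k.-1] of the definition is thus never attained. *)
Lemma robust_corner k P s u : robust_profile k P -> s \in P -> is_sep u ->
  sep_order (sep_join s u) < sep_order s ->
  sep_order (sep_join s (sep_inv u)) < sep_order s ->
  (sep_join s u \in P) || (sep_join s (sep_inv u) \in P).
Proof.
move=> [pP rP] sP us o1 o2; have [_ so] := profile_sep pP sP.
have [|c] := rP (sep_order u) s u sP; first by rewrite inE us /= ltnS.
have sk : sep_order s <= k.-1 by lia.
rewrite !inE => /orP[]/eqP-> /orP[|->]; rewrite ?orbT //.
  by rewrite leqNgt (leq_trans o1).
by rewrite leqNgt (leq_trans o2).
Qed.

(** For [k <= l], undistinguished profiles agree on all separations of order below [k], so [P] is
    contained in [Q]. A proper inclusion contradicts the maximality of [P] if [k < l], and is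
    impossible if [k = l]. *)
Lemma max_robust_dist k l P Q : max_robust_profile k P ->
  max_robust_profile l Q -> P <> Q -> exists s, distinguishes s P Q.
Proof.
wlog kl : k l P Q / k <= l.
  move=> H mP mQ PQ; case/orP: (leq_total k l) => h; first exact: H h _ _ _.
  case: (H _ _ _ _ h mQ mP) => [/esym//|s]; exists s.
  by rewrite distinguishes_sym.
move=> mP mQ PQ; apply: NNPP => nd.
have pP := proj1 (proj1 mP); have pQ := proj1 (proj1 mQ).
have eqm s : is_sep s -> sep_order s < k -> (s \in P) = (s \in Q).
  move=> ss sk; apply: (not_dist pP pQ) => //; first exact: leq_trans sk kl.
  by apply/negP=> h; apply: nd; exists s.
have sub : P \subset Q.
  by apply/subsetP=> s sP; case: (profile_sep pP sP) => a b; rewrite -eqm.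
have pr : P \proper Q by rewrite properEneq sub andbT; apply/eqP.
case: (ltngtP k l) kl => // [lt|e] _.
  by have := proj2 mP _ _ lt (proj1 mQ); rewrite pr.
case: PQ; apply/eqP; rewrite eqEsubset sub /=; apply/subsetP=> s sQ.
by case: (profile_sep pQ sQ) => a b; rewrite eqm // e.
Qed.

End ProfileTheory.

(** * Nested efficient distinguishers *)

Section EfficientDistinguishers.
Variable G : sgraph.
Implicit Types (s t u : sep_pair G) (P Q : {set sep_pair G}) (k l : nat).
Implicit Types (M : {set sep_pair G}).
Variable R : {set {set sep_pair G}}.

Definition cand M l P Q : pred (sep_pair G) := fun s =>
  [&& eff s P Q, sep_order s == l & [forall u in M, nested s u]].

Definition cands M l :=
  [set s | [exists P in R, exists Q in R, cand M l P Q s]].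

(** [M] holds the separations chosen at lower orders. Every minimiser of every pair is kept, so the
    level depends on no choice. *)
Definition level M l := [set s | [exists P in R, exists Q in R,
  cand M l P Q s && [forall u, cand M l P Q u ==>
    (#|crossing (cands M l) s| <= #|crossing (cands M l) u|)]]].

Fixpoint levels l :=
  if l is l'.+1 then levels l' :|: level (levels l') l' else set0.

(** [levels l] treats the orders below [l], and an order is at most [#|G|]. *)
Definition distinguishers := levels #|G|.+1.

Lemma candsP M l s : reflect
  (exists P Q, [/\ P \in R, Q \in R & cand M l P Q s]) (s \in cands M l).
Proof.
rewrite inE; apply: (iffP exists_inP) => [[P pR /exists_inP[Q qR h]]|].
  by exists P, Q.
by case=> P [Q [pR qR h]]; exists P => //; apply/exists_inP; exists Q.
Qed.

Lemma levelP M l s : reflect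
  (exists P Q, [/\ P \in R, Q \in R, cand M l P Q s &
     forall u, cand M l P Q u ->
       #|crossing (cands M l) s| <= #|crossing (cands M l) u|])
  (s \in level M l).
Proof.
rewrite inE; apply: (iffP exists_inP) => [[P pR /exists_inP[Q qR]]|].
  case/andP=> h /forallP h'; exists P, Q; split=> // u uc.
  by have := h' u; rewrite uc.
case=> P [Q [pR qR h h']]; exists P => //; apply/exists_inP; exists Q => //.
by rewrite h; apply/forallP=> u; apply/implyP/h'.
Qed.

Lemma candP M l P Q s : reflect
  [/\ eff s P Q, sep_order s = l & forall u, u \in M -> nested s u]
  (cand M l P Q s).
Proof.
apply: (iffP and3P) => -[a /eqP b c]; split=> //; first exact/forall_inP.
exact/forall_inP.
Qed.

Lemma cand_inv M l P Q s : cand M l P Q (sep_inv s) = cand M l P Q s.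
Proof.
rewrite /cand eff_inv sep_order_inv; do 2!congr andb.
by apply: eq_forallb => u; rewrite nested_invl.
Qed.

Lemma cand_sym M l P Q s : cand M l P Q s = cand M l Q P s.
Proof. by rewrite /cand eff_sym. Qed.

Lemma crossing_inv (E : {set sep_pair G}) s :
  crossing E (sep_inv s) = crossing E s.
Proof. by apply/setP=> u; rewrite !inE nested_invl. Qed.

Lemma level_inv M l s : s \in level M l -> sep_inv s \in level M l.
Proof.
case/levelP=> P [Q [pR qR h h']]; apply/levelP; exists P, Q.
by rewrite cand_inv crossing_inv.
Qed.

Lemma levels_inv l s : (sep_inv s \in levels l) = (s \in levels l).
Proof.
have h u : u \in levels l -> sep_inv u \in levels l.
  elim: l => [|l IH]; first by rewrite inE.
  rewrite /= !in_setU => /orP[/IH->//|/level_inv->]; exact: orbT.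
by apply/idP/idP => /h //; rewrite sep_invK.
Qed.

Hypothesis robR : forall P, P \in R -> exists k, robust_profile k P.

Lemma levels_eff l s : s \in levels l ->
  exists P Q, [/\ P \in R, Q \in R, eff s P Q & sep_order s < l].
Proof.
elim: l => [|l IH]; first by rewrite inE.
rewrite /= in_setU => /orP[/IH|/levelP].
  by case=> P [Q [pR qR e o]]; exists P, Q; split=> //; apply: leq_trans o _.
by case=> P [Q [pR qR /candP[e o _] _]]; exists P, Q; split=> //; rewrite o.
Qed.

(** If both corners above [s] were larger than [u], submodularity would make both corners above
    [sep_inv s] smaller than [s]. Whichever of [P], [Q] contains [sep_inv s] is robust and would
    contain one of these, which then distinguishes [P] from [Q] at an order below that of [s]. *)
Lemma lower_corner_order s u P Q P' Q' :
  P \in R -> Q \in R -> P' \in R -> Q' \in R ->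
  eff s P Q -> eff u P' Q' -> sep_order s < sep_order u -> ~~ nested s u ->
  s \in P' -> s \in Q' -> u \in P' ->
  eff (sep_join s u) P' Q' \/ eff (sep_join s (sep_inv u)) P' Q'.
Proof.
move=> /robR[p rP] /robR[q rQ] /robR[p' rP'] /robR[q' rQ'] es eu so su sP' sQ' uP'.
have pP := proj1 rP; have pQ := proj1 rQ.
have pP' := proj1 rP'; have pQ' := proj1 rQ'.
have ss := eff_sep es; have us := eff_sep eu.
have sp := dist_order pP (eff_dist es).
have sq := dist_orderr pQ (eff_dist es).
have up := dist_order pP' (eff_dist eu).
have uq := dist_orderr pQ' (eff_dist eu).
have uQ' : u \notin Q' by rewrite (dist_mem pP' pQ' (eff_dist eu)) uP'.
have [sj sj'] : is_sep (sep_join s u) /\ is_sep (sep_join s (sep_inv u)).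
  by rewrite !is_sep_join // is_sep_inv.
case: (leqP (sep_order (sep_join s u)) (sep_order u)) => o1.
  left; apply: (eff_le eu) => //;
    apply: (dist_of_mem pP' pQ' sj (leq_ltn_trans o1 up) (leq_ltn_trans o1 uq)).
  rewrite (profile_join pP' sP' uP') ?(leq_ltn_trans o1) //.
  apply/negP=> /eqP/esym h; case/negP: uQ'.
  exact: (profile_down pQ' h us uq (sep_le_joinr _ _)).
case: (leqP (sep_order (sep_join s (sep_inv u))) (sep_order u)) => o2.
  right; apply: (eff_le eu) => //;
    apply: (dist_of_mem pP' pQ' sj' (leq_ltn_trans o2 up) (leq_ltn_trans o2 uq)).
  rewrite (profile_join pQ' sQ' (u := sep_inv u)) ?(profile_inv pQ')
    ?(leq_ltn_trans o2) //.
  apply/negP=> /eqP h; case/negP: (profile_invN pP' uP').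
  apply: (profile_down pP' h _ _ (sep_le_joinr _ _)); first by rewrite is_sep_inv.
  by rewrite sep_order_inv.
exfalso.
have oc1 := order_corners s u; have oc2 := order_corners s (sep_inv u).
move: oc2; rewrite sep_order_inv sep_invK => oc2.
have {}oc1 : sep_order (sep_join (sep_inv s) (sep_inv u)) < sep_order s.
  by move: oc1 o1; clear; lia.
have {}oc2 : sep_order (sep_join (sep_inv s) u) < sep_order s.
  by move: oc2 o2; clear; lia.
(* [X] is the one of [P], [Q] that contains [sep_inv s], and [Y] is the other. *)
have key X Y x y : robust_profile x X -> is_profile y Y -> sep_order s < x ->
    sep_order s < y -> sep_inv s \in X -> s \in Y -> distinguishes s X Y ->
    (forall w, distinguishes w X Y -> sep_order s <= sep_order w) -> False.
  move=> rX pY sx sy sX sY d mn.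
  have pX := proj1 rX.
  have : (sep_join (sep_inv s) u \in X) || (sep_join (sep_inv s) (sep_inv u) \in X).
    by apply: (robust_corner rX) => //; rewrite sep_order_inv.
  have fin w : is_sep w -> sep_join (sep_inv s) w \in X ->
      sep_order (sep_join (sep_inv s) w) < sep_order s -> False.
    move=> ws h o; suff /mn : distinguishes (sep_join (sep_inv s) w) X Y.
      by rewrite leqNgt o.
    apply: distinguishesI; rewrite ?is_sep_join ?is_sep_inv //.
    apply: (profile_down pY sY).
    + by rewrite is_sep_inv is_sep_join ?is_sep_inv.
    + by rewrite sep_order_inv (ltn_trans o).
    by rewrite sep_le_invl sep_le_joinl.
  case/orP=> h; first exact: (fin u us h).
  by apply: (fin (sep_inv u) _ h); rewrite ?is_sep_inv.
have mP := dist_mem pP pQ (eff_dist es).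
case sP : (s \in P).
  apply: (key Q P q p) => //.
  - by rewrite (profile_inv pQ) // mP sP.
  - by rewrite distinguishes_sym eff_dist.
  - by move=> w; rewrite distinguishes_sym; apply: eff_min es.
apply: (key P Q p q) => //.
- by rewrite (profile_inv pP) // sP.
- by rewrite mP sP.
- exact: eff_dist.
by move=> w; apply: eff_min es.
Qed.

(** Among the efficient distinguishers, take one crossing as little of [M] as possible. If it still
    crosses some [t] in [M], then [t] has smaller order, so [P] and [Q] orient [t] alike, and
    [lower_corner_order] yields an efficient corner that crosses less. *)
Lemma cand_exists M l P Q s :
  P \in R -> Q \in R ->
  (forall t, t \in M -> sep_inv t \in M) ->
  (forall t, t \in M ->
     exists P Q, [/\ P \in R, Q \in R, eff t P Q & sep_order t < l]) ->
  (forall t u, t \in M -> u \in M -> nested t u) ->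
  eff s P Q -> sep_order s = l -> exists u, cand M l P Q u.
Proof.
move=> pR qR Minv Meff Mnest es so.
pose e u := eff u P Q.
case: (@arg_minnP _ s e (fun u => #|crossing M u|) es) => u eu umin.
have [p rP] := robR pR; have [q rQ] := robR qR.
have pP := proj1 rP; have pQ := proj1 rQ.
have uo : sep_order u = l.
  by apply/eqP; rewrite eqn_leq -{1}so -so (eff_min eu) ?(eff_min es) ?eff_dist.
exists u; apply/candP; split=> // t tM; apply: contraT; rewrite nested_sym => tu.
have up := dist_order pP (eff_dist eu).
have uq := dist_orderr pQ (eff_dist eu).
have [u' [eu' u'P cu' u'o tu']] : exists u', [/\ eff u' P Q, u' \in P,
    crossing M u' = crossing M u, sep_order u' = l & ~~ nested t u'].
  case uP : (u \in P); first by exists u.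
  exists (sep_inv u).
  by rewrite eff_inv (profile_inv pP) ?(eff_sep eu) // uP crossing_inv
    sep_order_inv nested_invr.
have tE := Meff t tM; have tl : sep_order t < l by case: tE => ? [? []].
have ts : is_sep t by case: tE => ? [? [_ _ /eff_sep]].
have tPQ : (t \in P) = (t \in Q).
  apply: (not_dist pP pQ) => //; rewrite ?(ltn_trans tl) -?uo //.
  by apply/negP=> /(eff_min eu); rewrite leqNgt uo tl.
have [t' [t'M t'P t'Q tu'']] :
    exists t', [/\ t' \in M, t' \in P, t' \in Q & ~~ nested t' u'].
  case tP : (t \in P); first by exists t; rewrite -tPQ.
  by exists (sep_inv t); rewrite (profile_inv pP) ?(profile_inv pQ) -?tPQ ?tP ?Minv
    ?nested_invl // ?(ltn_trans tl) -?uo.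
have better w : eff w P Q -> ~~ (crossing M w \proper crossing M u).
  by move=> ew; apply/negP=> /proper_card; rewrite ltnNge umin.
have t'n : forall w, w \in M -> nested w t' by move=> w wM; apply: Mnest.
have [X [Y [xR yR et' to]]] := Meff t' t'M.
have t'u : sep_order t' < sep_order u' by rewrite u'o.
have tu3 : ~~ nested t' (sep_inv u') by rewrite nested_invr.
have [/better|/better] := lower_corner_order xR yR pR qR et' eu' t'u tu'' t'P t'Q u'P.
  by rewrite -cu' crossing_join_proper.
by rewrite -cu' -(crossing_inv M u') crossing_join_proper.
Qed.

(** Each of the four profiles orients [s] and [u] and so lives in a quadrant. If a corner
    distinguishes [P] from [Q] and the opposite one [P'] from [Q'], submodularity forces both orders
    to be [l]. Both corners are then candidates, and minimality of [s] and [u] contradicts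
    [crossing_corners]. *)
Lemma level_nested M l s u :
  (forall t, t \in M -> sep_order t < l) ->
  s \in level M l -> u \in level M l -> nested s u.
Proof.
move=> Mo /levelP[P [Q [pR qR cs smin]]] /levelP[P' [Q' [pR' qR' cu umin]]].
apply: contraT => su.
have [es so sM] := candP _ _ _ _ _ cs; have [eu uo uM] := candP _ _ _ _ _ cu.
have ss := eff_sep es; have us := eff_sep eu.
pose x w := #|crossing (cands M l) w|.
(* Booleans name the quadrants: [true] keeps a separation and [false] inverts it, so
   [c (~~ b) (~~ d)] is the corner opposite to [c b d]. *)
pose ori (w : sep_pair G) (b : bool) := if b then w else sep_inv w.
pose c b d := sep_join (ori s b) (ori u d).
have oris w b : is_sep w -> is_sep (ori w b) by case: b; rewrite /= ?is_sep_inv.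
have orio w b : sep_order (ori w b) = sep_order w by case: b; rewrite /= ?sep_order_inv.
have oriinv w b : sep_inv (ori w b) = ori w (~~ b) by case: b; rewrite /= ?sep_invK.
have orin b d : ~~ nested (ori s b) (ori u d).
  by case: b d => [] []; rewrite /= ?nested_invl ?nested_invr.
have cs_ b d : is_sep (c b d) by apply: is_sep_join; apply: oris.
have co b d : sep_order (c b d) + sep_order (c (~~ b) (~~ d)) <= l + l.
  by have := order_corners (ori s b) (ori u d); rewrite !oriinv !orio so uo.
have cx b d : x (c b d) + x (c (~~ b) (~~ d)) < x s + x u.
  have sC : ori s b \in cands M l.
    apply/candsP; exists P, Q; split=> //.
    by case: (b); rewrite /= ?cand_inv.
  have := crossing_corners sC (orin b d); rewrite !oriinv.
  suff -> : crossing (cands M l) (ori s b) = crossing (cands M l) s.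
    suff -> : crossing (cands M l) (ori u d) = crossing (cands M l) u by [].
    by case: (d); rewrite /= ?crossing_inv.
  by case: (b); rewrite /= ?crossing_inv.
have cM b d t : t \in M -> nested (c b d) t.
  move=> tM; rewrite nested_sym nested_join //.
    by case: (b); rewrite /= ?nested_invr nested_sym sM.
  by case: (d); rewrite /= ?nested_invr nested_sym uM.
have memori X k w b : is_profile k X -> is_sep w -> sep_order w < k ->
    (ori w b \in X) = ((w \in X) == b).
  by move=> pX ws wk; case: b; rewrite /= ?(profile_inv pX) //; case: (w \in X).
(* For a pair of profiles both orienting [s] and [u], exactly one of which
   lives in the quadrant of the corner [c b d]. *)
have corner X Y v b d : X \in R -> Y \in R -> cand M l X Y v ->
    ((s \in X) == b) && ((u \in X) == d) (+) ((s \in Y) == b) && ((u \in Y) == d) ->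
    l <= sep_order (c b d) /\ (sep_order (c b d) <= l -> cand M l X Y (c b d)).
  move=> xR yR /candP[ev vo _].
  wlog : X Y xR yR ev / ((s \in X) == b) && ((u \in X) == d).
    move=> H; case h : (_ && _) => /= h'.
      by apply: (H X Y) => //; rewrite h.
    rewrite cand_sym; apply: (H Y X) => //; first by rewrite eff_sym.
    by rewrite h' h.
  move=> hX; rewrite hX /= => hY.
  have [i rX] := robR xR; have [j rY] := robR yR.
  have pX := proj1 rX; have pY := proj1 rY.
  have li := dist_order pX (eff_dist ev); have lj := dist_orderr pY (eff_dist ev).
  rewrite vo in li lj.
  have d_ : sep_order (c b d) <= l -> distinguishes (c b d) X Y.
    move=> cl; apply: (dist_of_mem pX pY _ (leq_ltn_trans cl li) (leq_ltn_trans cl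
      lj)) => //.
    rewrite (profile_join pX) /=; last exact: leq_ltn_trans cl li.
    - apply/negP=> /eqP/esym h; move: hY; rewrite -!(memori Y j) ?so ?uo //.
      rewrite (profile_down pY h _ _ (sep_le_joinl _ _)) ?oris ?orio ?so //.
      by rewrite (profile_down pY h _ _ (sep_le_joinr _ _)) ?oris ?orio ?uo.
    - by rewrite (memori X i) ?so //; case/andP: hX.
    by rewrite (memori X i) ?uo //; case/andP: hX.
  split.
    case: (leqP l (sep_order (c b d))) => // lt.
    by have := eff_min ev (d_ (ltnW lt)); rewrite vo leqNgt lt.
  move=> cl; apply/candP; split=> //; last by move=> t; apply: cM.
    by apply: (eff_le ev); rewrite ?vo // d_.
  apply/eqP; rewrite eqn_leq cl /=.
  by have := eff_min ev (d_ cl); rewrite vo.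
have [p rP] := robR pR; have [q rQ] := robR qR.
have [p' rP'] := robR pR'; have [q' rQ'] := robR qR'.
have sPQ := dist_mem (proj1 rP) (proj1 rQ) (eff_dist es).
have uPQ := dist_mem (proj1 rP') (proj1 rQ') (eff_dist eu).
have finish b d : 
    ((s \in P) == b) && ((u \in P) == d) (+) ((s \in Q) == b) && ((u \in Q) == d) ->
    ((s \in P') == ~~ b) && ((u \in P') == ~~ d) (+) ((s \in Q') == ~~ b) && ((u
      \in Q') == ~~ d) ->
    False.
  move=> h1 h2; have [o1 d1] := corner _ _ _ _ _ pR qR cs h1.
  have [o2 d2] := corner _ _ _ _ _ pR' qR' cu h2.
  have := co b d => o; have := cx b d.
  by rewrite ltnNge leq_add // /x ?smin ?umin // ?d1 ?d2 //; move: o o1 o2; clear; lia.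
(* The case that escapes [finish]: [P], [Q] occupy one diagonal and [P'], [Q'] the other. Both
   corners on the first diagonal compete with [s], which suffices once [u] crosses no more than [s]
   does. *)
have finish2 b d : 
    ((s \in P) == b) && ((u \in P) == d) (+) ((s \in Q) == b) && ((u \in Q) == d) ->
    ((s \in P) == ~~ b) && ((u \in P) == ~~ d) (+) ((s \in Q) == ~~ b) && ((u \in
      Q) == ~~ d) ->
    x u <= x s -> False.
  move=> h1 h2 us_; have [o1 d1] := corner _ _ _ _ _ pR qR cs h1.
  have [o2 d2] := corner _ _ _ _ _ pR qR cs h2.
  have := co b d => o; have := cx b d.
  rewrite ltnNge leq_add //; first by rewrite /x smin // d1 //; move: o o1 o2;
    clear; lia.
  by apply: (leq_trans us_); rewrite /x smin // d2 //; move: o o1 o2; clear; lia.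
(* In that case [s] distinguishes [P'] from [Q'] too, so it competes with [u]. *)
have us_ : (s \in P') != (s \in Q') -> x u <= x s.
  move=> h; apply: umin; apply/candP; split=> //.
  apply: (eff_le eu); rewrite ?so ?uo //.
  have o1 := dist_order (proj1 rP') (eff_dist eu).
  have o2 := dist_orderr (proj1 rQ') (eff_dist eu).
  by apply: (dist_of_mem (proj1 rP') (proj1 rQ')) => //; rewrite so -uo.
suff: False by [].
move: (finish true true) (finish true false) (finish false true) (finish false false).
move: (finish2 true true) (finish2 true false) us_; rewrite sPQ uPQ.
case: (s \in P) (u \in P) (u \in Q) (s \in P') (s \in Q') (u \in P')
  => [] [] [] [] [] [] g1 g2 xu f1 f2 f3 f4;
  first [ exact: (f1 isT isT) | exact: (f2 isT isT) | exact: (f3 isT isT)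
        | exact: (f4 isT isT) | exact: (g1 isT isT (xu isT))
        | exact: (g2 isT isT (xu isT)) ].
Qed.

Lemma levels_nested l s u : s \in levels l -> u \in levels l -> nested s u.
Proof.
elim: l s u => [|l IH] s u; first by rewrite inE.
have cross t v : t \in level (levels l) l -> v \in levels l -> nested t v.
  by case/levelP=> ? [? [_ _ /candP[_ _ h] _]] /h.
rewrite /= !in_setU => /orP[sl|sl] /orP[ul|ul].
- exact: IH.
- by rewrite nested_sym cross.
- exact: cross.
by apply: level_nested sl ul => t /levels_eff[? [? []]].
Qed.

Lemma levels_complete l P Q s : P \in R -> Q \in R -> eff s P Q ->
  sep_order s < l -> exists2 u, u \in levels l & eff u P Q.
Proof.
move=> pR qR es; elim: l => [|l IH] //; rewrite ltnS leq_eqVlt => /orP[/eqP so|].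
  have [u cu] : exists u, cand (levels l) l P Q u.
    apply: (cand_exists pR qR _ _ _ es so); first by move=> t; rewrite levels_inv.
      exact: levels_eff.
    exact: levels_nested.
  have [v cv vmin] := @arg_minnP _ u (cand (levels l) l P Q)
    (fun w => #|crossing (cands (levels l) l) w|) cu.
  exists v; last by case/candP: cv.
  by rewrite /= in_setU; apply/orP; right; apply/levelP; exists P, Q.
by case/IH=> u ul eu; exists u => //; rewrite /= in_setU ul.
Qed.

Lemma distinguishers_complete P Q s : P \in R -> Q \in R ->
  distinguishes s P Q -> exists2 u, u \in distinguishers & eff u P Q.
Proof.
move=> pR qR /eff_exists[u eu]; apply: (levels_complete pR qR eu).
by rewrite ltnS max_card.
Qed.

End EfficientDistinguishers.

(** * Automorphisms *)

Definition sep_img (G : sgraph) (f : {perm G}) (s : sep_pair G) : sep_pair G :=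
  (f @: s.1, f @: s.2).

Section Automorphisms.
Variables (G : sgraph).
Implicit Types (s t u : sep_pair G) (P Q : {set sep_pair G}) (k l : nat).
Implicit Types (f : {perm G}) (X Y : {set G}).

Lemma imset_permK f X : f^-1%g @: (f @: X) = X.
Proof.
by rewrite -imset_comp (eq_imset (g := id)) ?imset_id // => x /=; rewrite permK.
Qed.

Lemma graph_aut_inv f : graph_aut f -> graph_aut f^-1%g.
Proof. by move=> h x y; rewrite -h !permKV. Qed.

Lemma sep_imgK f : cancel (sep_img f) (sep_img f^-1%g).
Proof. by case=> A B; rewrite /sep_img /= !imset_permK. Qed.

Lemma sep_imgKV f : cancel (sep_img f^-1%g) (sep_img f).
Proof. by move=> s; rewrite -{1}[f]invgK sep_imgK. Qed.

Lemma sep_img_inj f : injective (sep_img f).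
Proof. exact: can_inj (sep_imgK f). Qed.

Lemma mem_sep_img f s P : (sep_img f s \in sep_img f @: P) = (s \in P).
Proof. exact: mem_imset (@sep_img_inj f). Qed.

Lemma mem_perm_img f (x : G) X : (f x \in f @: X) = (x \in X).
Proof. exact: mem_imset (@perm_inj _ f). Qed.

Lemma perm_img_sub f X Y : (f @: X \subset f @: Y) = (X \subset Y).
Proof.
apply/idP/idP; last exact: imsetS.
by move/(imsetS f^-1%g); rewrite !imset_permK.
Qed.

Lemma perm_imgI f X Y : f @: (X :&: Y) = f @: X :&: f @: Y.
Proof. by rewrite imsetI // => x y _ _; apply: perm_inj. Qed.

Lemma perm_imgC f X : f @: (~: X) = ~: (f @: X).
Proof.
apply/setP=> x; rewrite -[x](permKV f) inE !mem_perm_img.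
by rewrite inE.
Qed.

Lemma sep_img_inv f s : sep_img f (sep_inv s) = sep_inv (sep_img f s).
Proof. by []. Qed.

Lemma sep_img_le f s u : sep_le (sep_img f s) (sep_img f u) = sep_le s u.
Proof. by rewrite /sep_le /= !perm_img_sub. Qed.

Lemma sep_img_join f s u :
  sep_img f (sep_join s u) = sep_join (sep_img f s) (sep_img f u).
Proof. by rewrite /sep_img /sep_join /= imsetU perm_imgI. Qed.

Lemma sep_img_order f s : sep_order (sep_img f s) = sep_order s.
Proof. by rewrite /sep_order /= -perm_imgI card_imset //; apply: perm_inj. Qed.

Lemma sep_img_nested f s u : nested (sep_img f s) (sep_img f u) = nested s u.
Proof. by rewrite /nested -!sep_img_inv !sep_img_le. Qed.

Lemma sep_img_sep f s : graph_aut f -> is_sep (sep_img f s) = is_sep s.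
Proof.
move=> fa; apply/is_sepP/is_sepP=> /= -[h1 h2]; split=> [x|x y].
- by have := h1 (f x); rewrite !mem_perm_img.
- by rewrite -fa => /h2; rewrite !mem_perm_img.
- by rewrite -[x](permKV f) !mem_perm_img.
by rewrite -[x](permKV f) -[y](permKV f) fa !mem_perm_img => /h2.
Qed.

Lemma sep_img_dist f s P Q : graph_aut f ->
  distinguishes (sep_img f s) (sep_img f @: P) (sep_img f @: Q)
    = distinguishes s P Q.
Proof.
by move=> fa; rewrite /distinguishes sep_img_sep // -!sep_img_inv !mem_sep_img.
Qed.

Lemma sep_img_eff f s P Q : graph_aut f ->
  eff (sep_img f s) (sep_img f @: P) (sep_img f @: Q) = eff s P Q.
Proof.
move=> fa; apply/effP/effP => -[d h]; split.
- by rewrite -(sep_img_dist _ _ _ fa).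
- move=> u; rewrite -(sep_img_dist _ _ _ fa) => /h.
  by rewrite !sep_img_order.
- by rewrite sep_img_dist.
move=> u; rewrite -[u](sep_imgKV f) sep_img_dist // => /h.
by rewrite !sep_img_order.
Qed.

Lemma mem_sep_imgV f s P : (s \in sep_img f @: P) = (sep_img f^-1%g s \in P).
Proof. by rewrite -{1}[s](sep_imgKV f) mem_sep_img. Qed.

Section Distinguishers.
Variable R : {set {set sep_pair G}}.
Hypothesis Rimg : forall f P, graph_aut f -> P \in R -> sep_img f @: P \in R.

Definition img_closed (M : {set sep_pair G}) :=
  forall f s, graph_aut f -> s \in M -> sep_img f s \in M.

Lemma img_closedE M f s : img_closed M -> graph_aut f ->
  (sep_img f s \in M) = (s \in M).
Proof.
move=> h fa; apply/idP/idP; last exact: h.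
by move/(h _ _ (graph_aut_inv fa)); rewrite sep_imgK.
Qed.

Lemma cand_img M l f P Q s : img_closed M -> graph_aut f ->
  cand M l (sep_img f @: P) (sep_img f @: Q) (sep_img f s) = cand M l P Q s.
Proof.
move=> Mf fa; rewrite /cand sep_img_eff // sep_img_order; do 2!congr andb.
apply/forall_inP/forall_inP => h u uM.
  by rewrite -(sep_img_nested f) h // img_closedE.
rewrite -[u](sep_imgKV f) sep_img_nested h // -(img_closedE _ Mf fa).
by rewrite sep_imgKV.
Qed.

Lemma cands_img M l : img_closed M -> img_closed (cands R M l).
Proof.
move=> Mf f s fa /candsP[P [Q [pR qR h]]]; apply/candsP.
by exists (sep_img f @: P), (sep_img f @: Q); rewrite cand_img // !Rimg.
Qed.

Lemma crossing_img (M : {set sep_pair G}) f s : img_closed M -> graph_aut f ->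
  #|crossing M (sep_img f s)| = #|crossing M s|.
Proof.
move=> Mf fa; rewrite -(card_imset (crossing M s) (@sep_img_inj f)).
apply: eq_card => u; rewrite -[u](sep_imgKV f) mem_sep_img !inE.
by rewrite sep_img_nested img_closedE.
Qed.

Lemma level_img M l : img_closed M -> img_closed (level R M l).
Proof.
move=> Mf f s fa /levelP[P [Q [pR qR h smin]]]; apply/levelP.
exists (sep_img f @: P), (sep_img f @: Q); split; rewrite ?Rimg ?cand_img //.
move=> u; rewrite -[u](sep_imgKV f) cand_img // => /smin.
by rewrite !(crossing_img _ (@cands_img M l Mf) fa).
Qed.

Lemma levels_img l : img_closed (levels R l).
Proof.
elim: l => [|l IH] f s fa; first by rewrite inE.
rewrite /= !in_setU => /orP[/(IH f s fa)->//|/(level_img IH fa)->].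
exact: orbT.
Qed.

End Distinguishers.

Lemma profile_img k f P : graph_aut f -> is_profile k P ->
  is_profile k (sep_img f @: P).
Proof.
move=> fa [/subsetP p1 p2 p3 p4].
have so s : (sep_img f s \in seps_lt G k) = (s \in seps_lt G k).
  by rewrite !inE sep_img_sep // sep_img_order.
split.
- by apply/subsetP=> s /imsetP[u /p1 uP ->]; rewrite so.
- move=> s; rewrite -[s](sep_imgKV f) so -sep_img_inv !mem_sep_img.
  exact: p2.
- move=> s u; rewrite -[s](sep_imgKV f) -[u](sep_imgKV f) so !mem_sep_img sep_img_le.
  exact: p3.
move=> s u; rewrite -[s](sep_imgKV f) -[u](sep_imgKV f) -sep_img_join -sep_img_inv.
rewrite !mem_sep_img; exact: p4.
Qed.

Lemma robust_img k f P : graph_aut f -> robust_profile k P ->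
  robust_profile k (sep_img f @: P).
Proof.
move=> fa [pP rP]; split=> [|r s u]; first exact: profile_img.
rewrite -[s](sep_imgKV f) -[u](sep_imgKV f) mem_sep_img => sP.
rewrite inE sep_img_sep // sep_img_order => uo.
have [|c cin h] := rP r _ (sep_img f^-1%g u) sP; first by rewrite inE.
exists (sep_img f c); last by rewrite mem_sep_img sep_img_order.
by rewrite -(sep_img_inv f) -!(sep_img_join f) !inE !(inj_eq (@sep_img_inj f)) in cin *.
Qed.

Lemma max_robust_img k f P : graph_aut f -> max_robust_profile k P ->
  max_robust_profile k (sep_img f @: P).
Proof.
move=> fa [rP mP]; split=> [|l Q kl rQ]; first exact: robust_img.
have := mP l _ kl (robust_img (graph_aut_inv fa) rQ).
apply: contra => /properP[/subsetP sub [s sQ sP]]; apply/properP; split.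
  by apply/subsetP=> u uP; rewrite mem_sep_imgV invgK sub ?mem_sep_img.
by exists (sep_img f^-1%g s); rewrite ?mem_sep_img // -mem_sep_imgV.
Qed.

Lemma block_profile_img k f X : graph_aut f ->
  sep_img f @: block_profile k X = block_profile k (f @: X).
Proof.
move=> fa; apply/setP=> s; rewrite -[s](sep_imgKV f) mem_sep_img.
move: (sep_img f^-1%g s) => u; rewrite !inE.
by rewrite sep_img_sep // sep_img_order perm_img_sub.
Qed.

End Automorphisms.

(** * Separations around a block *)

Section Components.
Variable G : sgraph.
Implicit Types (b : {set G}) (v w x y : G).

Definition avoid_rel b : rel G :=
  fun x y => [&& adj x y, x \notin b & y \notin b].

(** The component of [v] in [G - b]. For [v] in [b] it degenerates to the singleton of [v]. *)
Definition component b v : {set G} := [set w | connect (avoid_rel b) v w].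

Definition component_sep b v : sep_pair G :=
  (component b v :|: [set w | [exists c in component b v, adj c w]], ~: component b v).

Lemma avoid_rel_sym b : connect_sym (avoid_rel b).
Proof.
apply: sym_connect_sym => x y; rewrite /avoid_rel adj_sym.
by congr andb; rewrite andbC.
Qed.

Lemma component_refl b v : v \in component b v.
Proof. by rewrite inE connect0. Qed.

Lemma component_ind b v (Pr : G -> Prop) : Pr v ->
  (forall x y, x \in component b v -> y \in component b v -> adj x y -> Pr x -> Pr y) ->
  forall w, w \in component b v -> Pr w.
Proof.
move=> pv step w; rewrite inE => /connectP[p pth ->].
elim/last_ind: p pth => [|p z IH] //; rewrite rcons_path last_rcons.
case/andP=> pth e; have vl : last v p \in component b v by rewrite inE;
  apply/connectP; exists p.
apply: (step (last v p)); last exact: IH; rewrite // ?inE; last by case/andP: e.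
by apply: (@connect_trans _ _ (last v p)); [rewrite inE in vl | apply: connect1].
Qed.

Lemma component_notin b v w : v \notin b -> w \in component b v -> w \notin b.
Proof.
move=> vb; rewrite inE => /connectP[p + ->].
by elim/last_ind: p => //= p z IH; rewrite rcons_path last_rcons => /andP[_ /and3P[]].
Qed.

Lemma component_adj b v x y : v \notin b -> x \in component b v -> adj x y ->
  y \notin b ->
  y \in component b v.
Proof.
move=> vb xC xy yb; have xb := component_notin vb xC; move: xC; rewrite !inE => vx.
by apply: connect_trans vx (connect1 _); rewrite /avoid_rel xy xb.
Qed.

Lemma component_eq b v w x : x \in component b v -> x \in component b w ->
  component b v = component b w.
Proof.
rewrite !inE => vx wx; apply/setP=> y; rewrite !inE.
have vw : connect (avoid_rel b) v w.
  by apply: connect_trans vx _; rewrite avoid_rel_sym.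
exact: (same_connect (@avoid_rel_sym b) vw).
Qed.

Lemma component_sep1E b v w : v \notin b -> w \in (component_sep b v).1 ->
  w \notin component b v -> w \in b.
Proof.
rewrite in_setU => vb /orP[->//|]; rewrite inE => /exists_inP[c cC cw].
by apply: contraR; apply: component_adj cw.
Qed.

Lemma is_sep_component b v : is_sep (component_sep b v).
Proof.
apply/is_sepP; split=> [x|x y xy]; rewrite /component_sep /= !in_setU !in_setC.
  by case: (x \in component b v); rewrite ?orbT.
have N z w : z \in component b v -> adj z w ->
  w \in [set w | [exists c in component b v, adj c w]].
  by move=> zC zw; rewrite inE; apply/exists_inP; exists z.
move: (N x y) (N y x); rewrite (adj_sym y) xy.
case: (x \in component b v) (y \in component b v) => [] [] //= h1 h2.
  by rewrite h1.
  by rewrite h2 ?orbT.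
by rewrite orbT.
Qed.

Lemma sub_component_sep b v : v \notin b -> b \subset (component_sep b v).2.
Proof.
move=> vb; apply/subsetP=> w wb; rewrite inE; apply/negP=> /(component_notin vb).
by rewrite wb.
Qed.

End Components.

Section BlockSeparations.
Variable G : sgraph.
Implicit Types (s t u : sep_pair G) (P Q : {set sep_pair G}) (k l : nat).
Implicit Types (b : {set G}) (v w x y : G).
Variable R : {set {set sep_pair G}}.
Hypothesis robR : forall P, P \in R -> exists k, robust_profile k P.
Hypothesis distR : forall P Q, P \in R -> Q \in R -> P <> Q ->
  exists s, distinguishes s P Q.

Local Notation N0 := (distinguishers R).

(** The properties of a separable block inducing a maximal robust profile on which the construction
    rests. The order bound is supplied by [component_sep_adhesion]. *)
Definition good b := exists k,
  [/\ is_profile k (block_profile k b), block_profile k b \in R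
    & forall v, v \notin b -> sep_order (component_sep b v) < k].

Definition toward b := [set s in N0 | b \subset s.2].

Definition max_toward b :=
  [set s in toward b | [forall u in toward b, sep_le s u ==> (u == s)]].

(* The part containing [b] of the tree-decomposition induced by [N0] alone. *)
Definition hub b : {set G} := \bigcap_(s in toward b) s.2.

Definition absorbed b v :=
  [set s in max_toward b | s.1 :&: s.2 :&: component b v != set0].

(** If nothing is absorbed, the empty union and the full intersection leave [component_sep b v]. *)
Definition block_sep b v : sep_pair G :=
  ((component_sep b v).1 :|: \bigcup_(s in absorbed b v) s.1,
   (component_sep b v).2 :&: \bigcap_(s in absorbed b v) s.2).

Lemma distinguishers_inv s : (sep_inv s \in N0) = (s \in N0).
Proof. exact: levels_inv. Qed.

Lemma distinguishers_nested s u : s \in N0 -> u \in N0 -> nested s u.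
Proof. exact: levels_nested. Qed.

Lemma distinguishers_eff s : s \in N0 -> exists P Q, [/\ P \in R, Q \in R & eff s P Q].
Proof. by case/levels_eff=> // P [Q [pR qR e _]]; exists P, Q. Qed.

Lemma distinguishers_sep s : s \in N0 -> is_sep s.
Proof. by case/distinguishers_eff=> P [Q [_ _ /eff_sep]]. Qed.

Lemma block_profile_sub k b s : s \in block_profile k b -> b \subset s.2.
Proof. by rewrite inE => /andP[]. Qed.

Lemma block_profile_nsub k b s : is_profile k (block_profile k b) ->
  s \in block_profile k b -> ~~ (b \subset s.1).
Proof.
move=> pP sP; have := profile_invN pP sP; have [ss so] := profile_sep pP sP.
by rewrite !inE is_sep_inv ss sep_order_inv so.
Qed.

Lemma mem_block_profile k b s : is_sep s -> sep_order s < k -> b \subset s.2 ->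
  s \in block_profile k b.
Proof. by rewrite !inE => -> -> ->. Qed.

(** A distinguisher need not distinguish the profile of [b] from anything efficiently, but one that
    does lies above one of its orientations. Hence the distinguishers maximal towards [b] are
    efficient for this profile. *)
Lemma distinguishers_block k b s : is_profile k (block_profile k b) ->
  block_profile k b \in R -> s \in N0 ->
  exists u Q, [/\ u \in N0, Q \in R, eff u (block_profile k b) Q,
    u \in block_profile k b & sep_le s u || sep_le (sep_inv s) u].
Proof.
set B := block_profile k b => pB bR.
(* Inverting [s] is allowed by the symmetric conclusion. For orders at least [k] the condition is
   vacuous. *)
wlog sQ' : s / sep_order s < k -> s \in B.
  move=> H sN; case/boolP: ((sep_order s < k) ==> (s \in B)) => [/implyP h|].
    exact: H.
  rewrite negb_imply => /andP[sk sB].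
  have /H[] : sep_order (sep_inv s) < k -> sep_inv s \in B.
  - by rewrite (profile_inv pB) // distinguishers_sep.
  - by rewrite distinguishers_inv.
  move=> u [Q [? ? ? ? h]]; exists u, Q; split=> //.
  by rewrite orbC; rewrite sep_invK in h.
move=> sN; have [P' [Q' [pR qR es]]] := distinguishers_eff sN.
wlog sP : P' Q' pR qR es / s \in P' /\ sep_inv s \in Q'.
  move=> H; case/andP: (eff_dist es) => _ /orP[]/andP[h1 h2].
    exact: (H P' Q').
  by apply: (H Q' P'); rewrite // eff_sym.
case: sP => sP' isQ'; have [p rP] := robR pR; have [q rQ] := robR qR.
have pP := proj1 rP; have pQ := proj1 rQ; have ss := distinguishers_sep sN.
have sq := dist_orderr pQ (eff_dist es); have sp := dist_order pP (eff_dist es).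
case: (ltnP (sep_order s) k) => sk.
  have {sQ'}sB := sQ' sk.
  have dB : distinguishes s B Q' by apply: distinguishesI.
  have [u uN eu] := distinguishers_complete robR bR qR dB.
  wlog uB : u uN eu / u \in B.
    move=> H; case uB: (u \in B); first exact: (H u).
    apply: (H (sep_inv u)); rewrite ?distinguishers_inv ?eff_inv //.
    by rewrite (profile_inv pB) ?uB ?(eff_sep eu) ?(dist_order pB (eff_dist eu)).
  have uQ : sep_inv u \in Q'.
    rewrite (profile_inv pQ) ?(eff_sep eu) ?(dist_orderr pQ (eff_dist eu)) //.
    by rewrite (dist_mem pB pQ (eff_dist eu)) uB.
  have us := eff_sep eu; have us_ := eff_min eu dB.
  case/or4P: (distinguishers_nested sN uN) => h.
  - by exists u, Q'; rewrite h.
  - case/negP: (profile_invN pQ isQ'); rewrite sep_invK.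
    exact: (profile_down pQ uQ).
  - case/negP: (profile_invN pB sB).
    by apply: (profile_down pB uB); rewrite ?is_sep_inv ?sep_order_inv.
  (* Here [u] lies below [s], hence in [P'], and so distinguishes [P'] from [Q']. Thus [s] is no
     larger than [u] and is itself efficient for [B] and [Q']. *)
  - exists s, Q'; split; rewrite ?sep_le_refl //.
    apply: (eff_le eu) => //; apply: (eff_min es).
    apply: distinguishesI => //.
    apply: (profile_down pP sP') => //; first exact: leq_ltn_trans us_ sp.
    by rewrite -sep_le_inv.
(* Now [s] is too large for [B]. A distinguisher [u] of [B] and [P'] is smaller than [s], so it
   cannot distinguish [P'] from [Q'], and neither of these contains [u]. *)
have BP : B <> P'.
  move=> e; have sB : s \in B by rewrite e.
  by have [_] := profile_sep pB sB; rewrite ltnNge sk.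
have [d dd] := distR bR pR BP.
have [u uN eu] := distinguishers_complete robR bR pR dd.
wlog uB : u uN eu / u \in B.
  move=> H; case uB: (u \in B); first exact: (H u).
  apply: (H (sep_inv u)); rewrite ?distinguishers_inv ?eff_inv //.
  by rewrite (profile_inv pB) ?uB ?(eff_sep eu) ?(dist_order pB (eff_dist eu)).
have us := eff_sep eu; have uk := dist_order pB (eff_dist eu).
have uP := dist_mem pB pP (eff_dist eu); rewrite uB /= in uP.
have uo : sep_order u < sep_order s by apply: leq_trans uk sk.
have uQ : u \in Q' = false.
  rewrite -uP; symmetry; apply: (not_dist pP pQ us (ltn_trans uo sp) (ltn_trans uo sq)).
  by apply/negP=> /(eff_min es); rewrite leqNgt uo.
have conclude : sep_le s u || sep_le (sep_inv s) u ->
  exists u Q, [/\ u \in N0, Q \in R, eff u B Q,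
    u \in B & sep_le s u || sep_le (sep_inv s) u].
  by move=> h; exists u, P'.
case/or4P: (distinguishers_nested sN uN) => h; try by apply: conclude; rewrite h ?orbT.
- rewrite sep_le_invr in h.
  by move: uQ; rewrite (profile_down pQ isQ' us (ltn_trans uo sq)).
rewrite sep_le_inv in h.
by move: uP; rewrite (profile_down pP sP' us (ltn_trans uo sp)).
Qed.

(** * Nestedness around a single block *)

Section OneBlock.
Variables (b : {set G}) (k : nat).
Let B := block_profile k b.
Hypothesis pB : is_profile k B.
Hypothesis bR : B \in R.
Hypothesis compk : forall v, v \notin b -> sep_order (component_sep b v) < k.

Lemma distinguishers_block_side s : s \in N0 -> (b \subset s.2) = ~~ (b \subset s.1).
Proof.
move=> sN; have [u [Q [uN qR eu uB /orP[]/andP[h1 h2]]]] := distinguishers_block pB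
  bR sN.
  rewrite (subset_trans (block_profile_sub uB) h2); symmetry.
  apply: contra (block_profile_nsub pB uB) => h; exact: subset_trans h h1.
rewrite (subset_trans (block_profile_sub uB) h2) /=; apply: negbTE.
apply: contra (block_profile_nsub pB uB) => h; exact: subset_trans h h1.
Qed.

Lemma toward_nsub s : s \in toward b -> ~~ (b \subset s.1).
Proof. by rewrite inE => /andP[sN]; rewrite distinguishers_block_side. Qed.

Lemma max_toward_eff s : s \in max_toward b ->
  exists2 Q, Q \in R & eff s B Q /\ s \in B.
Proof.
rewrite inE => /andP[st /forall_inP smax].
have sN : s \in N0 by move: st; rewrite inE => /andP[].
have [u [Q [uN qR eu uB /orP[]h]]] := distinguishers_block pB bR sN.
  have /smax : u \in toward b by rewrite inE uN (block_profile_sub uB).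
  by rewrite h => /eqP<-; exists Q.
case/negP: (block_profile_nsub pB uB); case/andP: h => h _.
by apply: subset_trans h; move: st; rewrite inE => /andP[].
Qed.

Lemma toward_max s : s \in toward b -> exists2 u, u \in max_toward b & sep_le s u.
Proof.
case/sep_max_above=> u [ut su umax]; exists u => //; rewrite inE ut.
by apply/forall_inP=> w wt; apply/implyP=> /(umax w wt)->.
Qed.

(** Of the other three nested positions, two contradict maximality and one would put [b] into a
    first side. *)
Lemma max_toward_star s u : s \in max_toward b -> u \in max_toward b ->
  s != u -> sep_le s (sep_inv u).
Proof.
rewrite inE => /andP[st /forall_inP smax].
rewrite inE => /andP[ut /forall_inP umax] su.
have [sN sb] : s \in N0 /\ b \subset s.2 by move: st; rewrite inE => /andP.
have [uN ub] : u \in N0 /\ b \subset u.2 by move: ut; rewrite inE => /andP.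
case/or4P: (distinguishers_nested sN uN) => // h.
- by case/negP: su; rewrite eq_sym; have /implyP-> := smax u ut.
- case/andP: h => h _; case/negP: (toward_nsub ut).
  exact: subset_trans sb h.
- by rewrite sep_le_inv in h; case/negP: su; have /implyP-> := umax s st.
Qed.

(** By robustness of [Q] and efficiency of [s], the corners of [sep_inv s] with [X] and with
    [sep_inv X] are not both smaller than [s]. Since [N(C)] lies in [b] and hence in [s.2], their
    separators are contained in that of [s], minus [C] or intersected with [X.1] respectively. The
    corner that is not smaller has the full separator. *)
Lemma component_dichotomy s v : s \in max_toward b -> v \notin b ->
  s.1 :&: s.2 :&: component b v = set0 \/ s.1 :&: s.2 \subset (component_sep b v).1.
Proof.
move=> sm vb; have [Q qR [es sB]] := max_toward_eff sm.
set X := component_sep b v; have [q rQ] := robR qR; have pQ := proj1 rQ.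
have ss := eff_sep es; have sq := dist_orderr pQ (eff_dist es).
have sQ : sep_inv s \in Q.
  by rewrite (profile_inv pQ) // (dist_mem pB pQ (eff_dist es)) sB.
have Xs : is_sep X := is_sep_component b v.
have bs := block_profile_sub sB.
have corner u : is_sep u -> sep_join (sep_inv s) u \in Q ->
    sep_order s <= sep_order (sep_join (sep_inv s) u).
  move=> us h; case: (leqP (sep_order s) (sep_order (sep_join (sep_inv s) u))) => // o.
  have sj : is_sep (sep_join (sep_inv s) u) by rewrite is_sep_join // is_sep_inv.
  have : distinguishes (sep_join (sep_inv s) u) B Q.
    rewrite -distinguishes_inv; apply: distinguishesI; rewrite ?is_sep_inv ?sep_invK //.
    apply: (profile_down pB sB); rewrite ?is_sep_inv ?sep_order_inv //.
      exact: ltn_trans o (dist_order pB (eff_dist es)).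
    by rewrite sep_le_invl sep_le_joinl.
  by move/(eff_min es); rewrite leqNgt o.
case: (leqP (sep_order s) (sep_order (sep_join (sep_inv s) X))) => o1.
  left; apply/eqP; rewrite -subset0; apply/subsetP=> w.
  suff : w \notin s.1 :&: s.2 :&: component b v by move/negbTE->.
  have sub : (s.2 :|: X.1) :&: (s.1 :&: X.2) \subset s.1 :&: s.2 :\: component b v.
    apply/subsetP=> z; rewrite !in_setI in_setU in_setD in_setI in_setC.
    case/andP=> h /andP[-> zC]; rewrite zC /=.
    case/orP: h => // zX; apply: (subsetP bs); exact: component_sep1E zX zC.
  have /eqP e : s.1 :&: s.2 :\: component b v == s.1 :&: s.2.
    by rewrite eqEcard subsetDl (leq_trans o1) // subset_leq_card.
  by rewrite -e in_setI in_setD; case: (w \in component b v); rewrite ?andbF.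
case: (leqP (sep_order s) (sep_order (sep_join (sep_inv s) (sep_inv X)))) => o2.
  right; apply/setIidPl/eqP; rewrite eqEcard subsetIl (leq_trans o2) //.
  apply/subset_leq_card/subsetP=> z; rewrite !in_setI in_setU in_setC.
  case/andP=> h /andP[-> zX]; rewrite zX /= andbT.
  case/orP: h => // zC; apply: (subsetP bs); exact: component_sep1E zX zC.
have /orP[] : (sep_join (sep_inv s) X \in Q) || (sep_join (sep_inv s) (sep_inv X)
  \in Q).
- by apply: (robust_corner rQ sQ Xs); rewrite sep_order_inv.
- by move/(corner _ Xs); rewrite leqNgt o1.
by move/(corner (sep_inv X)); rewrite is_sep_inv leqNgt o2 => /(_ Xs).
Qed.

Lemma max_toward_sub s : s \in max_toward b -> b \subset s.2.
Proof. by rewrite inE => /andP[+ _]; rewrite inE => /andP[]. Qed.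

Lemma max_toward_sep s : s \in max_toward b -> is_sep s.
Proof. by rewrite inE => /andP[+ _]; rewrite inE => /andP[/distinguishers_sep]. Qed.

(** The component is connected, starts in [s.2] and misses the separator of [s], so it never leaves
    the strict second side. *)
Lemma component_away s v w : s \in max_toward b -> v \in hub b ->
  s \notin absorbed b v ->
  w \in component b v -> (w \in s.2) && (w \notin s.1).
Proof.
move=> sm vh; rewrite inE sm /= negbK => /eqP s0.
have nin z : z \in component b v -> z \in s.2 -> z \notin s.1.
  move=> zC z2; apply/negP=> z1.
  by have := in_set0 z; rewrite -s0 !in_setI z1 z2 zC.
have vs : v \in s.2.
  by move/bigcapP: vh; apply; move: sm; rewrite inE => /andP[].
move: w; apply: component_ind; first by rewrite vs nin ?component_refl.
move=> x y xC yC xy /andP[x2 x1].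
have /is_sepP[_ /(_ x y xy)] := max_toward_sep sm.
by rewrite (negbTE x1) /= => /andP[_ y2]; rewrite y2 nin.
Qed.

Lemma is_sep_block_sep v : is_sep (block_sep b v).
Proof.
have ss s : s \in absorbed b v -> is_sep s.
  by rewrite inE => /andP[/max_toward_sep].
have h1 x : x \notin (block_sep b v).2 -> x \in (block_sep b v).1 /\
    (forall y, adj x y -> y \in (block_sep b v).1).
  rewrite in_setI negb_and in_setC negbK => /orP[xC|xs].
    split=> [|y xy]; rewrite in_setU in_setU; first by rewrite xC.
    apply/orP; left; apply/orP; right; rewrite inE.
    by apply/exists_inP; exists x.
  have [s sa xs2] : exists2 s, s \in absorbed b v & x \notin s.2.
    apply/exists_inP; apply: contraR xs; rewrite negb_exists => /forallP h.
    by apply/bigcapP=> s sa; have := h s; rewrite sa negbK.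
  have /is_sepP[cov adjs] := ss s sa.
  split=> [|y xy]; rewrite in_setU; apply/orP; right; apply/bigcupP; exists s => //.
    by have := cov x; rewrite (negbTE xs2) orbF.
  by have := adjs x y xy; rewrite (negbTE xs2) orbF => /andP[].
apply/is_sepP; split=> [x|x y xy].
  by case/boolP: (x \in (block_sep b v).2) => [_|/h1[->]]; rewrite ?orbT.
case/boolP: (x \in (block_sep b v).2) => [x2|/h1[-> /(_ y xy)->]//].
case/boolP: (y \in (block_sep b v).2) => [y2|/h1[-> /(_ x)]].
  by rewrite orbT.
by rewrite adj_sym => /(_ xy)->.
Qed.

Lemma block_sep_toward v : v \notin b -> b \subset (block_sep b v).2.
Proof.
move=> vb; rewrite subsetI sub_component_sep //=; apply/bigcapsP=> s.
by rewrite inE => /andP[/max_toward_sub].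
Qed.

Lemma absorbed_sub v s : v \notin b -> s \in absorbed b v ->
  s.1 :&: s.2 \subset (component_sep b v).1.
Proof.
move=> vb; rewrite inE => /andP[sm h].
by case: (component_dichotomy sm vb) => // e; rewrite e eqxx in h.
Qed.

(** An absorbed [s] meets [b] in first-side vertices of its separator only, and these lie in
    [C :|: N(C)] by the dichotomy. So it is enough that [C :|: N(C)] does not contain [b], which
    follows from its small neighbourhood. *)
Lemma block_sep_nsub v : v \notin b -> ~~ (b \subset (block_sep b v).1).
Proof.
move=> vb.
have cB : component_sep b v \in B.
  by apply: mem_block_profile; rewrite ?is_sep_component ?compk ?sub_component_sep.
apply: contra (block_profile_nsub pB cB) => /subsetP h; apply/subsetP=> w wb.
have := h w wb; rewrite in_setU => /orP[//|/bigcupP[s sa ws]].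
apply: (subsetP (absorbed_sub vb sa)); rewrite in_setI ws /=.
by apply: (subsetP (max_toward_sub _)) wb; move: sa; rewrite inE => /andP[].
Qed.

Lemma block_sep_notin v : v \notin (block_sep b v).2.
Proof. by rewrite in_setI in_setC component_refl. Qed.

(** An absorbed [s] lies below the join by construction. Any other one points away from [C] by
    [component_away] and from the absorbed separations by the star property. *)
Lemma max_toward_block_sep s v : v \in hub b -> v \notin b ->
  s \in max_toward b ->
  sep_le s (block_sep b v) || sep_le s (sep_inv (block_sep b v)).
Proof.
move=> vh vb sm; case/boolP: (s \in absorbed b v) => sa; apply/orP; [left|right].
  apply/andP; split.
    by apply: subset_trans (bigcup_sup s sa) (subsetUr _ _).
  by apply: subset_trans (subsetIr _ _) (bigcap_inf s sa).
have away := component_away sm vh sa.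
have star u : u \in absorbed b v -> sep_le s (sep_inv u).
  move=> ua; apply: max_toward_star => //.
    by move: ua; rewrite inE => /andP[].
  by apply: contraNneq sa => ->.
apply/andP; split; apply/subsetP=> w ws.
  rewrite in_setI in_setC; apply/andP; split.
    by apply/negP=> /away; rewrite ws andbF.
  by apply/bigcapP=> u /star/andP[/subsetP/(_ w ws)].
move: ws; rewrite in_setU => /orP[wX|/bigcupP[u /star/andP[_ /subsetP h] /h//]].
case/boolP: (w \in component b v) => [/away/andP[]//|wC].
by apply: (subsetP (max_toward_sub sm)); apply: component_sep1E wX wC.
Qed.

Lemma toward_block_sep s v : v \in hub b -> v \notin b -> s \in toward b ->
  sep_le s (block_sep b v) || sep_le s (sep_inv (block_sep b v)).
Proof.
move=> vh vb /toward_max[u um su].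
by case/orP: (max_toward_block_sep vh vb um) => /(sep_le_trans su)->; rewrite ?orbT.
Qed.

Lemma distinguishers_nested_block_sep s v : v \in hub b -> v \notin b -> s \in N0 ->
  nested s (block_sep b v).
Proof.
move=> vh vb.
wlog sb : s / b \subset s.2.
  move=> H sN; case/boolP: (b \subset s.2) => h; first exact: H.
  rewrite -nested_invl; apply: H; rewrite ?distinguishers_inv //=.
  by move: h; rewrite distinguishers_block_side // negbK.
move=> sN; have /(toward_block_sep vh vb)/orP[h|h] : s \in toward b by rewrite inE sN.
  exact: sep_le_nested.
by rewrite -nested_invr sep_le_nested.
Qed.

(** Equal components give equal separations. For different components the absorbed families are
    disjoint, because a separator absorbed at [C] lies in [C :|: b] and cannot meet another
    component; then each first side lies in the other second side. *)
Lemma block_sep_nested v w : v \in hub b -> v \notin b -> w \in hub b ->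
  w \notin b -> nested (block_sep b v) (block_sep b w).
Proof.
move=> vh vb wh wb; case/boolP: [exists x in component b v, x \in component b w].
  case/exists_inP=> x xv xw; have e := component_eq xv xw.
  by rewrite /block_sep /absorbed /component_sep e nested_refl.
rewrite negb_exists => /forallP disj.
have dis x : x \in component b v -> x \notin component b w.
  by move=> xv; have := disj x; rewrite xv.
have absN x y : x \notin b -> y \notin b ->
    (forall z, z \in component b x -> z \notin component b y) ->
    forall s, s \in absorbed b x -> s \notin absorbed b y.
  move=> xb yb dxy s sx; apply/negP=> sy; have := sy; rewrite inE => /andP[_].
  case/set0Pn=> z; rewrite inE => /andP[zs zy].
  have zx : z \notin component b x by apply/negP=> /dxy; rewrite zy.
  have := component_sep1E xb (subsetP (absorbed_sub xb sx) z zs) zx.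
  by rewrite (negbTE (component_notin yb zy)).
have absm x s : s \in absorbed b x -> s \in max_toward b by rewrite inE => /andP[].
have main x y : x \in hub b -> x \notin b -> y \in hub b -> y \notin b ->
    (forall z, z \in component b x -> z \notin component b y) ->
    (block_sep b x).1 \subset (block_sep b y).2.
  move=> xh xb yh yb dxy.
  have dyx z : z \in component b y -> z \notin component b x.
    by move=> zy; apply/negP=> /dxy; rewrite zy.
  apply/subsetP=> z; rewrite in_setU => /orP[zX|/bigcupP[s sx zs]]; last first.
    rewrite in_setI in_setC; apply/andP; split.
      apply/negP=> zy; have := component_away (absm _ _ sx) yh (absN _ _ xb yb dxy
        _ sx) zy.
      by rewrite zs andbF.
    apply/bigcapP=> u uy.
    have /andP[/subsetP h _] : sep_le s (sep_inv u).
      apply: max_toward_star; rewrite ?(absm _ _ sx) ?(absm _ _ uy) //.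
      by apply: contraNneq (absN _ _ xb yb dxy _ sx) => ->.
    exact: h.
  case/boolP: (z \in component b x) => zx.
    rewrite in_setI in_setC dxy //=; apply/bigcapP=> u uy.
    by have /andP[] := component_away (absm _ _ uy) xh (absN _ _ yb xb dyx _ uy) zx.
  exact: (subsetP (block_sep_toward yb) z (component_sep1E xb zX zx)).
rewrite -nested_invr sep_le_nested //; apply/andP; split; first exact: main.
by apply: main => // z zw; apply/negP=> /dis; rewrite zw.
Qed.

End OneBlock.

(** * The combined system for all blocks *)

Lemma good_toward b s : good b -> s \in N0 -> (b \subset s.2) = ~~ (b \subset s.1).
Proof. by case=> k [pB bR ck]; apply: distinguishers_block_side pB bR s. Qed.

(** The two profiles differ: since [component_sep b v] belongs to the profile of [b], a set with the
    same profile cannot contain any [v] outside [b]. A distinguisher of the profiles then separates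
    the sets. *)
Lemma good_separated b b' : good b -> good b' -> b <> b' ->
  exists s, [/\ s \in N0, b \subset s.2 & b' \subset s.1].
Proof.
move=> [k [pB bR ck]] [l [pB' bR' cl]] bb.
have PP : block_profile k b <> block_profile l b'.
  move=> e; apply: bb; apply/eqP; rewrite eqEsubset.
  have sub c d i j : block_profile i c = block_profile j d ->
      (forall v, v \notin c -> sep_order (component_sep c v) < i) -> d \subset c.
    move=> {}e ci; apply/subsetP=> v vd; apply/negPn/negP=> vc.
    have : component_sep c v \in block_profile i c.
      by rewrite mem_block_profile ?is_sep_component ?ci ?sub_component_sep.
    rewrite e => /block_profile_sub/subsetP/(_ v vd).
    by rewrite in_setC component_refl.
  by rewrite (sub _ _ _ _ e ck) (sub _ _ _ _ (esym e) cl).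
have [d dd] := distR bR bR' PP.
have [u uN eu] := distinguishers_complete robR bR bR' dd.
case/andP: (eff_dist eu) => us /orP[]/andP[h1 h2].
  by exists u; rewrite (block_profile_sub h1) (block_profile_sub h2).
exists (sep_inv u); rewrite distinguishers_inv.
by rewrite (block_profile_sub h1) (block_profile_sub h2).
Qed.

(** Only [v] in the hub needs a new separation; other vertices are cut off by a distinguisher
    already. The classical decision turns the proposition [good b] into a Boolean. *)
Definition block_seps : {set sep_pair G} := [set s | [exists b : {set G}, exists v,
  [&& (excluded_middle_informative (good b) : bool), v \in hub b, v \notin b
    & s == block_sep b v]]].

Definition tree_seps : {set sep_pair G} :=
  N0 :|: [set s | (s \in block_seps) || (sep_inv s \in block_seps)].

Lemma block_sepsP s : reflect
  (exists b v, [/\ good b, v \in hub b, v \notin b & s = block_sep b v])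
  (s \in block_seps).
Proof.
rewrite inE; apply: (iffP existsP) => [[b /existsP[v]]|[b [v [gb vh vb ->]]]].
  by case: excluded_middle_informative => //= gb /and3P[vh vb /eqP->]; exists b, v.
exists b; apply/existsP; exists v; rewrite vh vb eqxx.
by case: excluded_middle_informative.
Qed.

Lemma tree_seps_ind (Pr : sep_pair G -> Prop) :
  (forall s, Pr s -> Pr (sep_inv s)) -> (forall s, s \in N0 -> Pr s) ->
  (forall b v, good b -> v \in hub b -> v \notin b -> Pr (block_sep b v)) ->
  forall s, s \in tree_seps -> Pr s.
Proof.
move=> pi p0 pb s; rewrite in_setU => /orP[/p0//|]; rewrite inE.
case/orP=> /block_sepsP[b [v [gb vh vb e]]]; first by rewrite e; apply: pb.
by rewrite -[s]sep_invK; apply: pi; rewrite e; apply: pb.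
Qed.

Lemma tree_seps_inv s : (sep_inv s \in tree_seps) = (s \in tree_seps).
Proof.
rewrite /tree_seps in_setU [RHS]in_setU distinguishers_inv; congr orb.
by rewrite in_set [RHS]in_set sep_invK orbC.
Qed.

(** If [s.1] were everything, [sep_inv s] would lie below [s], so by consistency no profile could
    contain [s]. *)
Lemma distinguishers_proper s : s \in N0 -> s.1 != setT.
Proof.
case/distinguishers_eff=> P [Q [pR qR es]]; apply/eqP=> sT.
have [p rP] := robR pR; have [q rQ] := robR qR.
have ss := eff_sep es.
have le : sep_le (sep_inv s) s by rewrite /sep_le /= sT !subsetT.
have nP X k : is_profile k X -> sep_order s < k -> s \notin X.
  move=> pX sx; apply/negP=> sX; case/negP: (profile_invN pX sX).
  by apply: (profile_down pX sX); rewrite ?is_sep_inv ?sep_order_inv.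
case/andP: (eff_dist es) => _ /orP[]/andP[sX _].
  by move: sX; rewrite (negbTE (nP _ _ (proj1 rP) (dist_order (proj1 rP) (eff_dist
    es)))).
by move: sX; rewrite (negbTE (nP _ _ (proj1 rQ) (dist_orderr (proj1 rQ) (eff_dist
  es)))).
Qed.

Lemma tree_seps_proper s : s \in tree_seps -> s.1 != setT.
Proof.
suff : s \in tree_seps -> s.1 != setT /\ s.2 != setT by move=> h /h[].
move: s; apply: tree_seps_ind => [s []//|s sN|b v [k [pB bR ck]] vh vb].
  by rewrite !distinguishers_proper // -[s.2]/((sep_inv s).1) distinguishers_proper
    ?distinguishers_inv.
split; last first.
  by apply/eqP=> e; have := block_sep_notin b v; rewrite e in_setT.
apply: contraNneq (block_sep_nsub pB bR ck vb) => ->; exact: subsetT.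
Qed.

Lemma tree_seps_sep s : s \in tree_seps -> is_sep s.
Proof.
move: s; apply: tree_seps_ind => [s|s /distinguishers_sep//|b v _ _ _];
  first by rewrite is_sep_inv.
exact: is_sep_block_sep.
Qed.

Lemma good_toward_block_sep b s v : good b -> s \in N0 -> b \subset s.2 ->
  v \in hub b -> v \notin b ->
  sep_le s (block_sep b v) || sep_le s (sep_inv (block_sep b v)).
Proof.
move=> [k [pB bR ck]] sN sb vh vb.
by apply: (toward_block_sep pB bR vh vb); rewrite inE sN.
Qed.

Lemma distinguishers_nested_tree_seps s u : s \in N0 -> u \in tree_seps -> nested s u.
Proof.
move=> sN; move: u; apply: tree_seps_ind => [u|u uN|b v [k [pB bR ck]] vh vb].
- by rewrite nested_invr.
- exact: distinguishers_nested.
exact: (distinguishers_nested_block_sep pB bR vh vb sN).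
Qed.

(** For separations attached to different blocks, a distinguisher between the blocks is comparable
    to both, from opposite sides, and transitivity through it gives nestedness. *)
Lemma tree_seps_nested s u : s \in tree_seps -> u \in tree_seps -> nested s u.
Proof.
move=> sT; move: s sT u; apply: tree_seps_ind => [s h u /h|s sN u|b v gb vh vb].
- by rewrite nested_invl.
- exact: distinguishers_nested_tree_seps.
apply: tree_seps_ind => [u|u uN|c w gc wh wc].
- by rewrite nested_invr.
- rewrite nested_sym; apply: distinguishers_nested_tree_seps => //.
  by rewrite in_setU inE; apply/orP; right; apply/orP; left; apply/block_sepsP;
    exists b, v.
have [bc|/eqP bc] := eqVneq b c.
  rewrite -bc in wh wc *; case: gb => k [pB bR ck].
  exact: (block_sep_nested pB bR vh vb wh wc).
have [s [sN sb sc]] := good_separated gb gc bc.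
have h1 := good_toward_block_sep gb sN sb vh vb.
have h2 : sep_le (sep_inv s) (block_sep c w) || sep_le (sep_inv s) (sep_inv
  (block_sep c w)).
  by apply: good_toward_block_sep; rewrite ?distinguishers_inv.
case/orP: h1 => h1; case/orP: h2; rewrite sep_le_invl => h2;
  have h := sep_le_trans h2 h1; rewrite ?sep_invK in h.
- by rewrite -nested_invr nested_sym sep_le_nested.
- by rewrite nested_sym sep_le_nested.
- by rewrite -nested_invl -nested_invr nested_sym sep_le_nested.
by rewrite -nested_invl nested_sym sep_le_nested.
Qed.

Lemma good_side b s : good b -> s \in tree_seps -> (b \subset s.2) = ~~ (b \subset s.1).
Proof.
move=> gb; move: s; apply: tree_seps_ind => [s|s sN|c w gc wh wc].
- by move=> /= ->; rewrite negbK.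
- exact: good_toward.
have [bc|/eqP bc] := eqVneq b c.
  rewrite -bc in wh wc *; case: gb => k [pB bR ck].
  by rewrite block_sep_toward // (block_sep_nsub pB bR ck wc).
have [s [sN sb sc]] := good_separated gb gc bc.
have nsb : ~~ (b \subset s.1) by rewrite -good_toward.
have : sep_le (sep_inv s) (block_sep c w) || sep_le (sep_inv s) (sep_inv (block_sep
  c w)).
  by apply: good_toward_block_sep; rewrite ?distinguishers_inv.
case/orP=> /andP[/= h1 h2].
  rewrite (subset_trans sb h1) /=; apply: contraNF nsb => h; exact: subset_trans h h2.
rewrite (subset_trans sb h1); symmetry; apply: contra nsb => h;
  exact: subset_trans h h2.
Qed.

Lemma good_cut b v : good b -> v \notin b ->
  exists s, [/\ s \in tree_seps, b \subset s.2 & v \notin s.2].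
Proof.
move=> gb vb; case/boolP: (v \in hub b) => vh.
  exists (block_sep b v); rewrite block_sep_notin block_sep_toward //; split=> //.
  by rewrite in_setU inE; apply/orP; right; apply/orP; left; apply/block_sepsP;
    exists b, v.
have [s sb sv] : exists2 s, s \in toward b & v \notin s.2.
  apply/exists_inP; apply: contraR vh; rewrite negb_exists => /forallP h.
  by apply/bigcapP=> s sa; have := h s; rewrite sa negbK.
move: sb; rewrite inE => /andP[sN sb].
by exists s; split=> //; rewrite in_setU sN.
Qed.

End BlockSeparations.

(** * Invariance of the combined system under automorphisms *)

Section BlockSeparationImages.
Variable G : sgraph.
Variable R : {set {set sep_pair G}}.
Implicit Types (f : {perm G}) (b : {set G}) (s : sep_pair G) (v w : G).
Hypothesis Rimg : forall f P, graph_aut f -> P \in R -> sep_img f @: P \in R.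

Lemma component_img f b v : graph_aut f ->
  component (f @: b) (f v) = f @: component b v.
Proof.
have h (g : {perm G}) c x y : graph_aut g -> y \in component c x ->
  g y \in component (g @: c) (g x).
  move=> ga; rewrite !inE => /connectP[p + ->].
  elim: p x => [|z p IH] x; first by rewrite connect0.
  case/andP=> /and3P[xz xc zc] /IH; apply: connect_trans; apply: connect1.
  by rewrite /avoid_rel ga !mem_perm_img xz xc.
move=> fa; apply/setP=> w; rewrite -[w](permKV f) mem_perm_img; apply/idP/idP.
  by move/(h _ _ _ _ (graph_aut_inv fa)); rewrite imset_permK !permK.
exact: h.
Qed.

Lemma component_sep_img f b v : graph_aut f ->
  component_sep (f @: b) (f v) = sep_img f (component_sep b v).
Proof.
move=> fa; rewrite /component_sep /sep_img /= component_img // perm_imgC imsetU;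
  congr (_ :|: _, _).
apply/setP=> w; rewrite -[w](permKV f) mem_perm_img !inE.
apply/exists_inP/exists_inP => -[c].
  rewrite -[c](permKV f) mem_perm_img fa => cC cw.
  by exists (f^-1%g c).
by move=> cC cw; exists (f c); rewrite ?mem_perm_img ?fa.
Qed.

Lemma good_img f b : graph_aut f -> good R b -> good R (f @: b).
Proof.
move=> fa [k [pB bR ck]]; exists k; rewrite -block_profile_img //; split.
- exact: profile_img.
- exact: Rimg.
by move=> v; rewrite -[v](permKV f) mem_perm_img component_sep_img // sep_img_order
  => /ck.
Qed.

Lemma toward_img f b s : graph_aut f ->
  (sep_img f s \in toward R (f @: b)) = (s \in toward R b).
Proof.
move=> fa; rewrite in_set [RHS]in_set perm_img_sub.
by rewrite (img_closedE _ (@levels_img _ _ Rimg _)).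
Qed.

Lemma max_toward_img f b s : graph_aut f ->
  (sep_img f s \in max_toward R (f @: b)) = (s \in max_toward R b).
Proof.
move=> fa; rewrite /max_toward in_set [RHS]in_set (toward_img b s fa); congr andb.
apply/forall_inP/forall_inP => h u.
  rewrite -(toward_img _ _ fa) => /h.
  by rewrite sep_img_le (inj_eq (@sep_img_inj _ f)).
rewrite -[u](sep_imgKV f) toward_img // => /h.
by rewrite sep_img_le (inj_eq (@sep_img_inj _ f)).
Qed.

Lemma hub_img f b v : graph_aut f -> (f v \in hub R (f @: b)) = (v \in hub R b).
Proof.
move=> fa; apply/bigcapP/bigcapP => h s.
  by rewrite -(toward_img _ _ fa) => /h; rewrite mem_perm_img.
by rewrite -[s](sep_imgKV f) toward_img // => /h; rewrite mem_perm_img.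
Qed.

Lemma absorbed_img f b v s : graph_aut f ->
  (sep_img f s \in absorbed R (f @: b) (f v)) = (s \in absorbed R b v).
Proof.
move=> fa; rewrite in_set [RHS]in_set max_toward_img // component_img // /= -!perm_imgI.
by rewrite imset_eq0.
Qed.

Lemma block_sep_img f b v : graph_aut f ->
  block_sep R (f @: b) (f v) = sep_img f (block_sep R b v).
Proof.
move=> fa; rewrite /block_sep component_sep_img //.
case: (component_sep b v) => A C; rewrite /sep_img /= imsetU perm_imgI.
congr (_ :|: _, _ :&: _); apply/setP=> w; rewrite -[w](permKV f) mem_perm_img.
  apply/bigcupP/bigcupP => -[s]; last first.
    by move=> sa ws; exists (sep_img f s); rewrite ?absorbed_img ?mem_perm_img.
  rewrite -[s](sep_imgKV f) absorbed_img // mem_perm_img => sa ws.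
  by exists (sep_img f^-1%g s).
apply/bigcapP/bigcapP => h s.
  by rewrite -(absorbed_img _ _ _ fa) => /h; rewrite mem_perm_img.
by rewrite -[s](sep_imgKV f) absorbed_img // mem_perm_img => /h.
Qed.

Lemma block_seps_img f s : graph_aut f -> s \in block_seps R ->
  sep_img f s \in block_seps R.
Proof.
move=> fa /block_sepsP[b [v [gb vh vb ->]]]; apply/block_sepsP.
exists (f @: b), (f v); split; first exact: good_img.
- by rewrite hub_img.
- by rewrite mem_perm_img.
by rewrite block_sep_img.
Qed.

Lemma tree_seps_img : img_closed (tree_seps R).
Proof.
move=> f s fa; rewrite /tree_seps in_setU => /orP[sN|].
  by rewrite in_setU (@levels_img _ _ Rimg).
rewrite in_set in_setU in_set -sep_img_inv.
by case/orP=> /(block_seps_img fa)->; rewrite ?orbT.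
Qed.

End BlockSeparationImages.

(** * The tree of a nested system *)

Lemma path_exit (T : Type) (e : rel T) (a : pred T) x p :
  path e x p -> a x -> ~~ a (last x p) ->
  exists p1 y p2, [/\ p = p1 ++ y :: p2, e (last x p1) y, a (last x p1) & ~~ a y].
Proof.
elim: p x => [|y p IH] x /=; first by move=> _ ->.
case/andP=> xy pth ax nal; case/boolP: (a y) => ay; last by exists [::], y, p.
by have [p1 [z [p2 [-> ? ? ?]]]] := IH y pth ay nal; exists (y :: p1), z, p2.
Qed.

Section Orientations.
Variable G : sgraph.
Implicit Types (s t u w : sep_pair G) (O F : {set sep_pair G}).
Variable N : {set sep_pair G}.

(** [s \in O] means that [O] points to [s.2]; with this convention consistency is being closed
    downwards. *)
Definition consistent O : bool :=
  [&& O \subset N, [forall s in N, (s \in O) (+) (sep_inv s \in O)]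
    & [forall s in O, forall u in N, sep_le u s ==> (u \in O)]].

Definition node : finType := {O : {set sep_pair G} | consistent O}.

Definition flip s O : {set sep_pair G} := sep_inv s |: (O :\ s).

Definition node_adj : rel node := fun x y =>
  [exists s, (s \in val x) && (val y == flip s (val x))].

Hypothesis Ninv : forall s, (sep_inv s \in N) = (s \in N).
Hypothesis Nnested : forall s u, s \in N -> u \in N -> nested s u.
Hypothesis Nproper : forall s, s \in N -> s.1 != setT.
Hypothesis Nsep : forall s, s \in N -> is_sep s.

Lemma consistentP O : reflect
  [/\ forall s, s \in O -> s \in N,
      forall s, s \in N -> (sep_inv s \in O) = (s \notin O)
    & forall s u, s \in O -> u \in N -> sep_le u s -> u \in O]
  (consistent O).
Proof.
apply: (iffP and3P) => [[/subsetP h1 /forall_inP h2 /forall_inP h3]|[h1 h2 h3]].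
  split=> // [s /h2|s u sO uN us].
    by case: (s \in O) (sep_inv s \in O) => [] [].
  by have /forall_inP/(_ u uN)/implyP := h3 s sO; apply.
split; first exact/subsetP.
  by apply/forall_inP=> s /h2 ->; case: (s \in O).
apply/forall_inP=> s sO; apply/forall_inP=> u uN; apply/implyP; exact: h3.
Qed.

Lemma node_sub (x : node) s : s \in val x -> s \in N.
Proof. by case/consistentP: (valP x) => h _ _; apply: h. Qed.

Lemma node_inv (x : node) s : s \in N -> (sep_inv s \in val x) = (s \notin val x).
Proof. by case/consistentP: (valP x) => _ h _; apply: h. Qed.

Lemma node_down (x : node) s u : s \in val x -> u \in N -> sep_le u s -> u \in val x.
Proof. by case/consistentP: (valP x) => _ _; apply. Qed.

(** [sep_le s (sep_inv s)] would make [s.2] the whole vertex set, against properness. This is what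
    lets either orientation of [s] extend to a node. *)
Lemma sep_le_invN s : s \in N -> ~~ sep_le s (sep_inv s).
Proof.
move=> sN; apply/negP=> /andP[/= /subsetP h _].
have /is_sepP[cov _] := Nsep sN.
have /eqP[] : (sep_inv s).1 != setT by apply: Nproper; rewrite Ninv.
by apply/setP=> x; rewrite in_setT /=; case/orP: (cov x) => // /h.
Qed.

Lemma sep_le_both s u : s \in N -> sep_le u s -> ~ sep_le (sep_inv u) s.
Proof.
move=> sN us ius; have : ~~ sep_le (sep_inv s) (sep_inv (sep_inv s)).
  by rewrite sep_le_invN ?Ninv.
by rewrite sep_invK => /negP[]; apply: sep_le_trans us; rewrite sep_le_invl.
Qed.

Lemma sep_inv_neq s : s \in N -> sep_inv s != s.
Proof. by move/sep_le_invN; apply: contraNneq => ->; apply: sep_le_refl. Qed.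

Lemma node_adj_flip (x y : node) s : node_adj x y -> s \in val x ->
  s \notin val y -> val y = flip s (val x).
Proof.
case/existsP=> r /andP[rx /eqP e] sx; rewrite e !inE negb_or negb_and sx orbF negbK.
by case/andP=> _ /eqP->.
Qed.

(** If the nodes containing [s] differed in some [u], the flips of [s] would leave this difference
    in place at the other ends, and each way of nesting [u] with [s] contradicts consistency of one
    of the four ends. *)
Lemma edge_unique (x y x' y' : node) s :
  node_adj x y -> s \in val x -> s \notin val y ->
  node_adj x' y' -> s \in val x' -> s \notin val y' -> x = x' /\ y = y'.
Proof.
have half (x1 y1 x2 y2 : node) : node_adj x1 y1 -> s \in val x1 -> s \notin val y1 ->
    node_adj x2 y2 -> s \in val x2 -> s \notin val y2 -> val x1 \subset val x2.
  move=> a1 sx1 sy1 a2 sx2 sy2; have sN := node_sub sx1.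
  have e1 := node_adj_flip a1 sx1 sy1; have e2 := node_adj_flip a2 sx2 sy2.
  apply/subsetP=> u ux1; have uN := node_sub ux1.
  apply/negPn/negP=> ux2.
  have us : u != s by apply: contraNneq ux2 => ->.
  have uis : u != sep_inv s.
    by apply: contraTneq ux1 => ->; rewrite node_inv // sx1.
  have uy1 : u \in val y1 by rewrite e1 !inE us ux1 orbT.
  have iux2 : sep_inv u \in val x2 by rewrite node_inv.
  have iuy2 : sep_inv u \in val y2.
    rewrite e2 !inE iux2 andbT orbC; apply/orP; left.
    by apply: contraNneq uis => <-; rewrite sep_invK.
  case/or4P: (Nnested uN sN) => h.
  - by move: ux2; rewrite (node_down sx2 uN h).
  - have : sep_inv s \in val y2 by rewrite node_inv.
    move/(fun h' => node_down h' uN h); apply/negP.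
    by rewrite -node_inv.
  - have : sep_inv s \in val x1 by apply: (node_down ux1); rewrite ?Ninv // sep_le_invl.
    by rewrite node_inv // sx1.
  - rewrite sep_le_inv in h.
    by move: sy1; rewrite (node_down uy1 sN h).
move=> a1 s1 s1' a2 s2 s2'.
have e : x = x'.
  apply/val_inj/eqP; rewrite eqEsubset.
  by rewrite (half x y x' y') // (half x' y' x y).
split=> //; apply: val_inj; rewrite (node_adj_flip a1 s1 s1') (node_adj_flip a2 s2 s2').
by rewrite e.
Qed.

Lemma flip_flip (x : node) s : s \in val x -> flip (sep_inv s) (flip s (val x)) = val x.
Proof.
move=> sx; have sN := node_sub sx; apply/setP=> u; rewrite !inE sep_invK.
have [->|us] /= := eqVneq u s; first by rewrite sx.
have [->|//] := eqVneq u (sep_inv s).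
by rewrite /= node_inv // sx.
Qed.

Lemma node_adj_sym : symmetric node_adj.
Proof.
have h x y : node_adj x y -> node_adj y x.
  case/existsP=> s /andP[sx /eqP e]; apply/existsP; exists (sep_inv s).
  by rewrite e flip_flip // eqxx andbT !inE eqxx.
by move=> x y; apply/idP/idP; apply: h.
Qed.

Lemma node_adj_irrefl : irreflexive node_adj.
Proof.
move=> x; apply/negbTE/negP=> /existsP[s /andP[sx /eqP e]].
have : sep_inv s \in val x by rewrite e !inE eqxx.
by rewrite node_inv ?sx //; apply: node_sub sx.
Qed.

Definition node_graph := SGraph node_adj_sym node_adj_irrefl.

(** A maximal such superset orients everything: if it contained neither orientation of [s], the
    whole down-set of [s] could be added. *)
Lemma extend_consistent F : F \subset N ->
  (forall s u, s \in F -> u \in N -> sep_le u s -> u \in F) ->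
  (forall s, s \in F -> sep_inv s \notin F) ->
  exists x : node, F \subset val x.
Proof.
move=> FN Fd Fi.
pose ok (F : {set sep_pair G}) := [&& F \subset N,
  [forall s in F, forall u in N, sep_le u s ==> (u \in F)]
  & [forall s in F, sep_inv s \notin F]].
have okF : ok F.
  apply/and3P; split=> //; last by apply/forall_inP.
  apply/forall_inP=> s sF; apply/forall_inP=> u uN; apply/implyP; exact: Fd sF uN.
have [O /maxsetP[/and3P[ON /forall_inP Od /forall_inP Oi] Omax] FO] :=
  maxset_exists okF.
have {}Od s u : s \in O -> u \in N -> sep_le u s -> u \in O.
  by move=> sO uN; have /forall_inP/(_ u uN)/implyP := Od s sO.
suff cO : consistent O by exists (Sub O cO : node).
apply/consistentP; split=> // [s sO|s sN]; first exact: (subsetP ON).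
apply/idP/idP => [h|sO].
  by apply/negP=> /Oi; rewrite h.
apply/negPn/negP=> isO.
pose O' := O :|: [set u in N | sep_le u s].
have : ok O'.
  apply/and3P; split.
  - by rewrite subUset ON; apply/subsetP=> u; rewrite inE => /andP[].
  - apply/forall_inP=> u; rewrite in_setU => uO; apply/forall_inP=> w wN.
    apply/implyP=> wu; rewrite in_setU in_set wN; case/orP: uO => [uO|].
      by rewrite (Od u w).
    by rewrite in_set => /andP[_ us]; rewrite (sep_le_trans wu us) orbT.
  apply/forall_inP=> u; rewrite !in_setU !in_set negb_or negb_and.
  have lem w : w \in O -> sep_le (sep_inv w) s -> False.
    move=> wO ws; case/negP: isO; apply: (Od w) => //; first by rewrite Ninv.
    by rewrite sep_le_invl.
  case/orP=> [uO|/andP[uN us]].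
    rewrite Oi //=; apply/orP; right; apply/negP; exact: lem.
  apply/andP; split; first by apply/negP=> h; apply: (lem _ h); rewrite sep_invK.
  by apply/orP; right; apply/negP; apply: sep_le_both.
move/Omax => /(_ (subsetUl _ _)) e; case/negP: sO.
by rewrite -e in_setU in_set sN sep_le_refl orbT.
Qed.

(* [X] will be empty, a vertex or an edge of [G]. *)
Lemma node_through (X : {set G}) s0 :
  (forall s, s \in N -> (X \subset s.1) || (X \subset s.2)) ->
  s0 \in N -> X \subset s0.2 ->
  exists2 x : node, s0 \in val x & forall s, s \in val x -> X \subset s.2.
Proof.
move=> Xs s0N s0X.
(* The orientations forced by [X], together with those forced by [s0]. *)
pose F := [set u in N | ~~ (X \subset u.1) || sep_le u s0].
have [x Fx] : exists x : node, F \subset val x.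
  apply: extend_consistent.
  - by apply/subsetP=> u; rewrite inE => /andP[].
  - move=> s u; rewrite !in_set => /andP[sN h] uN us; rewrite uN /=.
    case/orP: h => [sX|/(sep_le_trans us)->]; last exact: orbT.
    apply/orP; left; apply: contra sX => h; apply: subset_trans h _.
    by case/andP: us.
  move=> s; rewrite !in_set Ninv => /andP[sN h]; rewrite sN /= negb_or negbK.
  have le2 u : sep_le u s0 -> X \subset u.2.
    by case/andP=> _; apply: subset_trans s0X.
  case/orP: h => [sX|ss0].
    have := Xs s sN; rewrite (negbTE sX) /= => -> /=.
    by apply: contra sX => /le2.
  by rewrite (le2 s ss0); apply/negP; apply: sep_le_both.
exists x; first by apply: (subsetP Fx); rewrite inE s0N sep_le_refl orbT.
move=> s sx; have sN := node_sub sx; apply/negPn/negP=> sX.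
have : sep_inv s \in val x by apply: (subsetP Fx); rewrite inE Ninv sN sX.
by rewrite node_inv // sx.
Qed.

Lemma node_exists (X : {set G}) :
  (forall s, s \in N -> (X \subset s.1) || (X \subset s.2)) ->
  exists x : node, forall s, s \in val x -> X \subset s.2.
Proof.
move=> Xs; have [N0|[s sN]] := set_0Vmem N.
  have [||s|x _] := @extend_consistent set0; rewrite ?sub0set // ?inE //.
  - by move=> s u; rewrite inE.
  - by exists x => s /node_sub; rewrite N0 inE.
have [u uN uX] : exists2 u, u \in N & X \subset u.2.
  case/orP: (Xs s sN) => h; last by exists s.
  by exists (sep_inv s); rewrite ?Ninv.
by have [x _ h] := node_through Xs uN uX; exists x.
Qed.

(** Maximality means that nothing left in the set lies above the removed [s]. Dually, anything other
    than [sep_inv s] below [sep_inv s] was already in [x], since its inverse lies above [s]. *)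
Lemma flip_consistent (x : node) s : s \in val x ->
  (forall u, u \in val x -> sep_le s u -> u = s) -> consistent (flip s (val x)).
Proof.
move=> sx smax; have sN := node_sub sx.
apply/consistentP; split=> [u|u uN|u w].
- rewrite !inE => /orP[/eqP->|/andP[_ /node_sub//]]; by rewrite Ninv.
- rewrite !inE (inj_eq (can_inj (@sep_invK G))) node_inv //.
  rewrite -[sep_inv u == s](inj_eq (can_inj (@sep_invK G))) sep_invK.
  have [->|us] := eqVneq u s.
    by rewrite sx /= orbF eq_sym (negbTE (sep_inv_neq sN)).
  by have [->|] := eqVneq u (sep_inv s).
rewrite !inE => /orP[/eqP->|/andP[us ux]] wN wu; last first.
  rewrite (node_down ux wN wu) andbT orbC.
  apply/orP; left; apply: contraNneq us => ws; rewrite ws in wu.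
  by rewrite (smax u ux wu).
have [//|wis] /= := eqVneq w (sep_inv s).
have ws : w != s.
  by apply: contraTneq wu => ->; apply: sep_le_invN.
rewrite ws /=; apply/negPn/negP=> wx; case/negP: wis; apply/eqP.
rewrite -[w]sep_invK; congr sep_inv; apply: smax; first by rewrite node_inv.
by rewrite sep_le_invr.
Qed.

(** Flip a maximal element of [val x :\: val y]; it is maximal in [val x] because [val y] is closed
    downwards. Empty [I] gives connectedness, and a singleton gives connectedness of one side of an
    edge. *)
Lemma node_connect (I : {set sep_pair G}) (x y : node) :
  I \subset val x -> I \subset val y ->
  connect (fun x y => [&& node_adj x y, I \subset val x & I \subset val y]) x y.
Proof.
move En : #|val x :\: val y| => n; elim: n x En => [|n IH] x En Ix Iy.
  have xy : val x \subset val y by rewrite -setD_eq0 -cards_eq0 En.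
  suff -> : x = y by apply: connect0.
  apply/val_inj/eqP; rewrite eqEsubset xy; apply/subsetP=> s sy.
  have sN := node_sub sy; apply/negPn/negP; rewrite -node_inv // => /(subsetP xy).
  by rewrite node_inv // sy.
have [s0 s0D] : exists s, s \in val x :\: val y.
  by apply/set0Pn; rewrite -cards_eq0 En.
have [s [sD _ smax]] := sep_max_above s0D.
have [sx sy] : s \in val x /\ s \notin val y by move: sD; rewrite inE => /andP[].
have sN := node_sub sx.
have smax' u : u \in val x -> sep_le s u -> u = s.
  move=> ux su; apply: smax => //; rewrite inE ux andbT.
  by apply: contra sy => uy; apply: node_down su.
pose z : node := Sub (flip s (val x)) (flip_consistent sx smax').
have xz : node_adj x z by apply/existsP; exists s; rewrite sx SubK eqxx.
have Iz : I \subset val z.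
  rewrite SubK; apply/subsetP=> u uI; rewrite !inE (subsetP Ix u uI) andbT orbC.
  by apply/orP; left; apply: contraNneq sy => <-; apply: (subsetP Iy).
apply: (@connect_trans _ _ z); first by apply: connect1; rewrite xz Ix Iz.
apply: IH => //; apply/eqP; rewrite -eqSS -En (cardsD1 s (val x :\: val y)) sD
  add1n eqSS.
rewrite eqn_leq; apply/andP; split; apply/subset_leq_card/subsetP=> u.
  rewrite !inE => /andP[uy /orP[/eqP us|/andP[us ux]]]; last by rewrite us uy.
  by move: uy; rewrite us node_inv // sy.
by rewrite !inE => /and3P[-> -> ->]; rewrite orbT.
Qed.

Lemma node_edge s : s \in N ->
  exists x y : node, [/\ node_adj x y, s \in val x & s \notin val y].
Proof.
move=> sN; have iN : sep_inv s \in N by rewrite Ninv.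
have Xs u : u \in N -> (set0 \subset u.1) || (set0 \subset u.2) by rewrite sub0set.
have [x sx _] := node_through Xs sN (sub0set _).
have [y sy _] := node_through Xs iN (sub0set _).
have /connectP[p pth yl] := node_connect (sub0set (val x)) (sub0set (val y)).
have sly : s \notin val (last x p) by rewrite -yl -node_inv.
have [p1 [z [p2 [_ /and3P[a _ _] sl sz]]]] :=
  path_exit (a := fun x : node => s \in val x) pth sx sly.
by exists (last x p1), z.
Qed.

(** If the first edge of a cycle flips [s], the rest of the cycle must flip it back, and by
    [edge_unique] it does so along the same edge. A cycle of length at least 3 would then repeat a
    vertex. *)
Lemma node_graph_tree : is_tree node_graph.
Proof.
split.
- have [] := @node_exists set0; first by move=> s _; rewrite sub0set.
  by move=> x _; apply/card_gt0P; exists x.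
- move=> x y; have := node_connect (sub0set (val x)) (sub0set (val y)).
  apply: connect_sub => {}x {}y /and3P[xy _ _]; exact: connect1.
case=> [|x [|y [|z p]]] //; rewrite /ucycle /= => /andP[/and3P[xy yz pth]].
case/and3P; rewrite !inE !negb_or => /and3P[nxy nxz xp] /andP[nyz yp] _.
case/existsP: (xy) => s /andP[sx /eqP ye].
have sN := node_sub sx.
have sy : s \notin val y by rewrite -node_inv // ye !inE eqxx.
have yx_path : path node_adj y (rcons (z :: p) x) by rewrite /= yz.
have nsx : ~~ (s \notin val (last y (rcons (z :: p) x))) by rewrite last_rcons negbK.
have [p1 [t [p2 [e a sl st]]]] :=
  path_exit (a := fun x : node => s \notin val x) yx_path sy nsx.
rewrite negbK in st; rewrite node_adj_sym in a.
have [tx ly] := edge_unique a st sl xy sx sy.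
case: p1 e ly {a sl} => [|t1 p1] /= [e1 e2]; first by rewrite e1 -tx eqxx in nxz.
move=> ly; have : y \in rcons (z :: p) x.
  by rewrite /= e1 e2 -ly -cat_cons mem_cat mem_last.
by rewrite mem_rcons !inE eq_sym (negbTE nxy) (negbTE nyz) (negbTE yp).
Qed.

(** * The parts of the decomposition and the separations it induces *)

Definition node_part (x : node) : {set G} := \bigcap_(s in val x) s.2.

(** If some [s] in [t2] excluded [v], both ends of the path would lack [s]. The path would enter and
    leave the nodes containing [s] through the same edge, visiting its outer end before and after
    [t2]. *)
Lemma node_part_path (t1 t2 : node) (p : seq node) :
  path node_adj t1 p -> uniq (t1 :: p) -> t2 \in t1 :: p ->
  node_part t1 :&: node_part (last t1 p) \subset node_part t2.
Proof.
move=> pth; rewrite inE => u12 /orP[/eqP->|]; first exact: subsetIl.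
move=> t2p; apply/subsetP=> v; rewrite inE => /andP[v1 vl].
apply/bigcapP=> s s2; have sN := node_sub s2; apply/negPn/negP=> vs.
have out (t : node) : v \in node_part t -> s \notin val t.
  by move/bigcapP=> h; apply: contra vs => /h.
case/splitPr: t2p pth u12 vl => p1 p2.
rewrite cat_path last_cat -cat_cons => /andP[pth1 /andP[a1 pth2]] u12 vl.
have pth12 : path node_adj t1 (rcons p1 t2) by rewrite rcons_path pth1.
have s12 : ~~ (s \notin val (last t1 (rcons p1 t2))) by rewrite last_rcons negbK.
have [q1 [y [q2 [e a sx sy]]]] :=
  path_exit (a := fun x : node => s \notin val x) pth12 (out _ v1) s12.
rewrite negbK in sy; rewrite node_adj_sym in a.
have [r1 [z [r2 [e' a' sx' sz]]]] :=
  path_exit (a := fun x : node => s \in val x) pth2 s2 (out _ vl).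
have [_ xz] := edge_unique a sy sx a' sx' sz.
have sub1 : {subset t1 :: q1 <= t1 :: p1}.
  have [r ->] : exists r, p1 = q1 ++ r.
    case/lastP: q2 e => [|q2 w]; first by rewrite cats1 => /rcons_inj[->];
      exists [::]; rewrite cats0.
    by rewrite -rcons_cons -rcons_cat => /rcons_inj[-> _]; exists (y :: q2).
  by move=> w; rewrite !inE mem_cat => /orP[->//|->]; rewrite orbT.
have z1 : z \in t1 :: p1 by apply: sub1; rewrite -xz mem_last.
have z2 : z \in t2 :: p2 by rewrite e' inE mem_cat inE eqxx !orbT.
move: u12; rewrite cat_uniq.
by case/and3P=> _ /hasPn/(_ z z2) /=; rewrite z1.
Qed.

Lemma node_part_vertex x : exists t : node, x \in node_part t.
Proof.
have [|t ht] := @node_exists [set x].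
  by move=> s /Nsep/is_sepP[cov _]; rewrite !sub1set cov.
by exists t; apply/bigcapP=> s /ht; rewrite sub1set.
Qed.

Lemma node_part_edge x y : adj x y ->
  exists t : node, (x \in node_part t) && (y \in node_part t).
Proof.
move=> xy; have [|t ht] := @node_exists [set x; y].
  by move=> s /Nsep/is_sepP[_ /(_ x y xy)]; rewrite !subUset !sub1set.
by exists t; apply/andP; split; apply/bigcapP=> s /ht;
  rewrite subUset !sub1set => /andP[].
Qed.

Lemma node_part_cover : \bigcup_(t : node) node_part t = setT.
Proof.
apply/setP=> x; rewrite in_setT; apply/bigcupP.
by have [t xt] := node_part_vertex x; exists t.
Qed.

Definition node_td : tree_dec G := @TreeDec G node_graph node_part node_graph_tree
  node_part_cover node_part_edge node_part_path.

Lemma node_td_side (x y : node) s : node_adj x y ->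
  s \in val x -> s \notin val y -> @edge_side G node_td x y = s.2.
Proof.
move=> xy sx sy; have sN := node_sub sx.
have side (t : node) : connect (@tree_del_edge G node_td x y) x t = (s \in val t).
  apply/idP/idP.
    case/connectP=> p pth ->; apply: contraT => st.
    have [p1 [z [p2 [_ a s1 sz]]]] := path_exit (a := fun x : node =>
      s \in val x) pth sx st.
    case/andP: a => a; have [<- <-] := edge_unique xy sx sy a s1 sz.
    by rewrite mem_head.
  move=> st; have sub (z : node) : s \in val z ->
    [set s] \subset val z by rewrite sub1set.
  apply: connect_sub (node_connect (sub _ sx) (sub _ st)) => z w.
  rewrite !sub1set => /and3P[zw sz sw]; apply: connect1.
  apply/andP; split; first exact: zw.
  rewrite !inE negb_or; apply/andP; split.
    by apply: contra sy => /eqP[_ <-].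
  by apply: contra sy => /eqP[<- _].
apply/setP=> v; apply/bigcupP/idP => [[t]|v2].
  by rewrite side => st /bigcapP; apply.
(* A vertex of [s.2] must lie in a part on this side of the edge, so the node is sought among those
   containing [s]. *)
have [|||t st ht] := @node_through [set v] s; rewrite ?sub1set //.
  by move=> u /Nsep/is_sepP[cov _]; rewrite !sub1set cov.
exists t; first by rewrite side.
by apply/bigcapP=> u /ht; rewrite sub1set.
Qed.

Lemma node_td_induced s : s \in N ->
  exists x y : td_tree node_td, adj x y /\ induced_sep x y = s.
Proof.
move=> sN; have iN : sep_inv s \in N by rewrite Ninv.
(* The side of [x] is the second side of the separation contained in [x], so to obtain [s.1] first,
   [x] must contain [sep_inv s]. *)
have [x [y [xy sx sy]]] := node_edge iN.
exists x, y; split=> //; rewrite /induced_sep (node_td_side xy sx sy).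
have yx : node_adj y x by rewrite node_adj_sym.
rewrite (node_td_side (s := s) yx); first by case: (s).
  by rewrite -[s]sep_invK node_inv.
by rewrite -[s]sep_invK node_inv // sx.
Qed.

Lemma node_td_canonical : img_closed N -> td_canonical node_td.
Proof.
move=> Nimg f fa.
have cimg (x : node) : consistent (sep_img f @: val x).
  apply/consistentP; split=> [s|s|s u].
  - by case/imsetP=> u /node_sub uN ->; apply: Nimg.
  - rewrite -[s](sep_imgKV f) -sep_img_inv !mem_sep_img (img_closedE _ Nimg fa).
    exact: node_inv.
  rewrite -[s](sep_imgKV f) -[u](sep_imgKV f) !mem_sep_img (img_closedE _ Nimg fa).
  rewrite sep_img_le.
  exact: node_down.
pose g (x : node) : node := Sub (sep_img f @: val x) (cimg x).
have ginj : injective g.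
  move=> x y /(congr1 val); rewrite !SubK => e; apply/val_inj.
  exact: imset_inj (@sep_img_inj _ f) _ _ e.
have gadj x y : node_adj x y -> node_adj (g x) (g y).
  case/existsP=> s /andP[sx /eqP e]; apply/existsP; exists (sep_img f s).
  rewrite !SubK mem_sep_img sx e; apply/eqP/setP=> u; rewrite -[u](sep_imgKV f).
  rewrite mem_sep_img !inE -sep_img_inv !(inj_eq (@sep_img_inj _ f)).
  by rewrite mem_sep_img.
have gadjE x y : node_adj (g x) (g y) = node_adj x y.
  apply/idP/idP; last exact: gadj.
  case/existsP=> s; rewrite !SubK -[s](sep_imgKV f) mem_sep_img => /andP[sx /eqP e].
  apply/existsP; exists (sep_img f^-1%g s); rewrite sx; apply/eqP/setP=> u.
  move/setP/(_ (sep_img f u)): e; rewrite mem_sep_img => ->.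
  by rewrite !inE -sep_img_inv !(inj_eq (@sep_img_inj _ f)) mem_sep_img.
exists (perm ginj : {perm td_tree node_td}) => [x y|x]; rewrite !permE.
  exact: gadjE.
apply/setP=> v; rewrite -[v](permKV f) mem_perm_img.
apply/bigcapP/bigcapP => h s sx.
  move: sx; rewrite -[s](sep_imgKV f) /g SubK mem_sep_img.
  by move: (sep_img _ s) => u /h; rewrite /= mem_perm_img.
have := h (sep_img f s); rewrite /g SubK mem_sep_img /= mem_perm_img; exact.
Qed.

(** Pointing every separation towards [b] defines a node, whose part is [b] since all other vertices
    are cut off. A node whose part contains [b] points the same way everywhere. *)
Lemma node_td_block (b : {set G}) :
  (forall s, s \in N -> (b \subset s.2) = ~~ (b \subset s.1)) ->
  (forall v, v \notin b -> exists s, [/\ s \in N, b \subset s.2 & v \notin s.2]) ->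
  exists t : td_tree node_td, b = part t /\
    forall t' : td_tree node_td, b \subset part t' -> t' = t.
Proof.
move=> bs bv; pose O := [set s in N | b \subset s.2].
have cO : consistent O.
  apply/consistentP; split=> [s|s sN|s u].
  - by rewrite inE => /andP[].
  - by rewrite !inE Ninv sN /= bs // negbK.
  rewrite !inE => /andP[_ sb] -> /andP[_]; exact: subset_trans sb.
exists (Sub O cO : node); split=> [|t bt].
  apply/setP=> v; apply/idP/bigcapP => [vb s|h].
    by rewrite SubK inE => /andP[_ /subsetP]; apply.
  apply/negPn/negP=> /bv[s [sN sb]] /negP; apply; apply: h.
  by rewrite SubK inE sN.
have sub : val t \subset O.
  apply/subsetP=> s st; rewrite inE (node_sub st).
  by apply: subset_trans bt _; apply: bigcap_inf.
apply/val_inj/eqP; rewrite SubK eqEsubset sub; apply/subsetP=> s sO.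
have sN : s \in N by move: sO; rewrite inE => /andP[].
apply/negPn/negP; rewrite -node_inv // => /(subsetP sub).
by rewrite !inE Ninv sN /=; move: sO; rewrite inE sN bs //= => /negbTE->.
Qed.

End Orientations.

(** * Separable blocks *)

Section SeparableBlocks.
Variables (G : sgraph) (T : tree_dec G) (t : td_tree T).
Implicit Types (v w x y : G) (r q : td_tree T).

Local Notation away := (connect (@avoid_rel (td_tree T) [set t])).

Lemma path_away r p : path (@adj (td_tree T)) r p -> t \notin r :: p ->
  path (avoid_rel [set t]) r p.
Proof.
elim: p r => [|q p IH] r //= /andP[rq pth];
  rewrite !inE !negb_or eq_sym => /and3P[a b c].
by rewrite /avoid_rel rq !inE a eq_sym b IH // inE negb_or b.
Qed.

Lemma vertex_nodes_away v r q : v \notin part t -> v \in part r -> v \in part q ->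
  away r q.
Proof.
move=> vt vr vq; have [_ conn _] := td_is_tree T.
have /connectP[p0 pth0 ql] := conn r q; rewrite ql in vq *.
case/shortenP: pth0 vq => p pth up _ vq.
apply/connectP; exists p => //; apply: path_away => //.
apply: contra vt => tp; apply: (subsetP (td_path pth up tp)).
by rewrite inE vr.
Qed.

Lemma component_nodes_away v w r q : v \notin part t -> v \in part r ->
  w \in component (part t) v -> w \in part q -> away r q.
Proof.
move=> vt vr wC; move: w wC q.
apply: component_ind => [q vq|x y xC yC xy IH q yq]; first exact: vertex_nodes_away vq.
have [m /andP[xm ym]] := td_edge T xy.
apply: connect_trans (IH m xm) _.
by apply: vertex_nodes_away ym yq; apply: component_notin yC.
Qed.

(** Prepending [t] to a path from [r] to [q] avoiding [t] closes a cycle; its length is at most 2,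
    so the path is trivial. *)
Lemma tree_nbr_unique r q : adj t r -> adj t q -> away r q -> r = q.
Proof.
move=> tr tq /connectP[p0 pth0 ql]; rewrite ql in tq *.
case/shortenP: pth0 tq => p pth up _ tq.
have [_ _ acyc] := td_is_tree T.
have sub : subrel (avoid_rel [set t]) (@adj (td_tree T)) by move=> x y /and3P[].
have tp : t \notin r :: p.
  rewrite inE negb_or; apply/andP; split.
    by apply: contraTneq tr => <-; rewrite adj_irrefl.
  elim: (p) (r) pth => //= z p' IH x /andP[/and3P[_ _ zt] /IH];
    rewrite inE negb_or => ->.
  by rewrite eq_sym andbT; move: zt; rewrite inE.
have /acyc : ucycle (@adj (td_tree T)) [:: t, r & p].
  rewrite /ucycle [uniq _]/= tp -[X in _ && X]/(uniq (r :: p)) up andbT.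
  by rewrite /= tr rcons_path (sub_path sub pth) adj_sym.
by case: (p).
Qed.

(** The nodes meeting the component lie in one component of the tree minus [t], which contains a
    single neighbour [q] of [t]. Paths from [t] to these nodes pass through [q], so the neighbours
    of the component lie in [part t :&: part q]. *)
Lemma component_sep_adhesion v : v \notin part t ->
  sep_order (component_sep (part t) v) <= adhesion T.
Proof.
move=> vt.
have /bigcupP[r _ vr] : v \in \bigcup_(q : td_tree T) part q by rewrite (td_cover
  T) in_setT.
set S := component_sep _ _; rewrite /sep_order.
have nbr w : w \in S.1 :&: S.2 ->
    exists q, [/\ adj t q, away r q, w \in part t & w \in part q].
  rewrite inE in_setC => /andP[wX wC]; have wt := component_sep1E vt wX wC.
  move: wX; rewrite in_setU (negbTE wC) inE => /exists_inP[c cC cw].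
  have [m /andP[cm wm]] := td_edge T cw.
  have [_ conn _] := td_is_tree T.
  have /connectP[p0 pth0 ml] := conn t m.
  have ct := component_notin vt cC.
  have rm := component_nodes_away vt vr cC cm.
  rewrite ml in cm wm rm; case/shortenP: pth0 cm wm rm => -[|q p] pth up _ cm wm rm.
    by rewrite (negbTE ct) in cm.
  exists q; case/andP: pth => tq pth; split=> //.
    apply: connect_trans rm _; rewrite avoid_rel_sym; apply/connectP; exists p => //.
    by apply: path_away => //; case/andP: up.
  apply: (subsetP (td_path (p := q :: p) _ up _)); rewrite ?inE ?eqxx ?orbT //.
    by rewrite /= tq.
  by rewrite wt.
have [->|[w0 /nbr[q [tq rq _ _]]]] := set_0Vmem (S.1 :&: S.2); first by rewrite cards0.
apply: (leq_trans _ (leq_bigmax_cond (F := fun e : td_tree T * td_tree T =>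
  #|part e.1 :&: part e.2|) (t, q) tq)).
apply/subset_leq_card/subsetP=> w /nbr[q' [tq' rq' wt wq']].
rewrite inE wt (tree_nbr_unique tq tq') //.
by apply: connect_trans rq'; rewrite avoid_rel_sym.
Qed.

End SeparableBlocks.

Theorem theorem2 (G : sgraph) :
  exists T : tree_dec G,
    [/\ td_canonical T,
        forall (k l : nat) (P Q : {set sep_pair G}),
          max_robust_profile k P -> max_robust_profile l Q -> P <> Q ->
          td_distinguishes_eff T P Q
      & forall (k : nat) (b : {set G}),
          separable_block k b -> max_robust_profile k (block_profile k b) ->
          exists t : td_tree T,
            b = part t /\ forall t' : td_tree T, b \subset part t' -> t' = t].
Proof.
(* Classical decision is used because being a maximal robust profile is a proposition quantifying
   over all [k], [l] and [r]. *)
pose R : {set {set sep_pair G}} := [set P |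
  (excluded_middle_informative (exists k, max_robust_profile k P) : bool)].
have inR P : (P \in R) <-> exists k, max_robust_profile k P.
  by rewrite inE; case: excluded_middle_informative.
have robR P : P \in R -> exists k, robust_profile k P.
  by case/inR=> k [rP _]; exists k.
have distR P Q : P \in R -> Q \in R -> P <> Q -> exists s, distinguishes s P Q.
  by case/inR=> k mP /inR[l mQ]; apply: max_robust_dist mP mQ.
have Rimg f P : graph_aut f -> P \in R -> sep_img f @: P \in R.
  by move=> fa /inR[k mP]; apply/inR; exists k; apply: max_robust_img.
exists (node_td (tree_seps_inv R) (tree_seps_nested robR distR)
  (tree_seps_proper robR distR) (@tree_seps_sep G R)).
split.
- exact/node_td_canonical/tree_seps_img.
- move=> k l P Q mP mQ PQ; have pR : P \in R by apply/inR; exists k.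
  have qR : Q \in R by apply/inR; exists l.
  have [d dd] := distR P Q pR qR PQ.
  have [s sN /effP es] := distinguishers_complete robR pR qR dd.
  have sT : s \in tree_seps R by rewrite in_setU sN.
  have [x [y [xy e]]] := node_td_induced (tree_seps_inv R)
    (tree_seps_nested robR distR) (tree_seps_proper robR distR)
    (@tree_seps_sep G R) sT.
  by exists x, y; rewrite e.
move=> k b [_ [T [adh [t tb]]]] mB.
have gb : good R b.
  exists k; split; first by case: mB => -[].
    by apply/inR; exists k.
  move=> v; rewrite -tb => vt; apply: leq_ltn_trans adh.
  by apply: component_sep_adhesion.
apply: node_td_block => [s|v]; first exact: good_side.
exact: good_cut.
Qed.
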